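(* Let $\Sigma\subseteq\mathbb{C}$ be a nonempty finite set, let $L$ be a bounded band operator on $\ell^2(\mathbb{Z})$ with $LS=SL$, and let $\gamma\in\mathbb{Z}$. For $u\in\Sigma^{\mathbb{N}}$ let $H(u)^+$ be the half-axis generalized Schrödinger operator on $\ell^2(\mathbb{N})$ (defined in the context). Let $b,b_1,b_2,\ldots\in\Sigma^{\mathbb{N}}$, and put $A^+:=H(b)^+$ and $A_m^+:=H(b_m)^+$. Suppose that \[ \forall N\in\mathbb{N}\ \exists m_0\in\mathbb{N}\ \forall m\ge m_0:\quad \mathcal{W}_N(b_m)=\mathcal{W}_N(b), \] and that $b_m\to b$ pointwise. Then, for all $\lambda\in\mathbb{C}$ and $\varepsilon>0$, as $m\to\infty$, \[ \|(A_m^+-\lambda)^{-1}\|\to\|(A^+-\lambda)^{-1}\|\qquad\text{and}\qquad\sigma_\varepsilon(A_m^+)\to\sigma_\varepsilon(A^+)\ \text{in the Hausdorff distance.} \] If, in addition, all $A_m^+$ and $A^+$ are normal, then also $\sigma(A_m^+)\to\sigma(A^+)$ in the Hausdorff distance.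
   Context: $\mathbb{N}=\{1,2,3,\dots\}$. $S$ is the shift on $\ell^2(\mathbb{Z})$, $(Sx)_n=x_{n-1}$; $M_u$ is multiplication by $u$. A band operator on $\ell^2(\mathbb{Z})$ is a finite sum $\sum_{k=-w}^{w}M_{a^{(k)}}S^k$ with $a^{(k)}\in\ell^\infty(\mathbb{Z})$. For an operator $A$ on $\ell^2(\mathbb{Z})$ with matrix $(A_{ij})_{i,j\in\mathbb{Z}}$, its compression $A^+$ is the operator on $\ell^2(\mathbb{N})$ with matrix $(A_{ij})_{i,j\in\mathbb{N}}$. For $u\in\Sigma^{\mathbb{N}}$, $H(u)^+$ denotes the compression to $\mathbb{N}$ of $L+S^\gamma M_{\tilde u}$, where $\tilde u\in\Sigma^{\mathbb{Z}}$ is any extension of $u$ (the compression does not depend on the choice of extension). For $u\in\Sigma^{\mathbb{N}}$ and $N\in\mathbb{N}$, $\mathcal{W}_N(u)$ is the set of subwords $(u(k),\dots,u(k+N-1))$, $k\in\mathbb{N}$. $\sigma(T)$ is the spectrum; $\sigma_\varepsilon(T):=\{\lambda:\|(T-\lambda)^{-1}\|>1/\varepsilon\}$ with $\|B^{-1}\|:=\infty$ if $B$ is not invertible. *)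

(* Defs.v *)
From Stdlib Require Import Reals Lra ZArith List Classical ClassicalEpsilon.
From Coquelicot Require Import Coquelicot.
Open Scope R_scope.

(* Conventions: sequences indexed by the paper's N = {1,2,...} are represented
   by functions nat -> C with the shift  (paper index n) <-> (Rocq index n-1). *)

Definition l2 (x : nat -> C) : Prop := ex_series (fun n => (Cmod (x n)) ^ 2).
Definition l2norm (x : nat -> C) : R := sqrt (Series (fun n => (Cmod (x n)) ^ 2)).

Definition matop (M : nat -> nat -> C) (x : nat -> C) : nat -> C :=
  fun i => (Series (fun j => fst (Cmult (M i j) (x j))),
            Series (fun j => snd (Cmult (M i j) (x j)))).

Definition subId (M : nat -> nat -> C) (lam : C) : nat -> nat -> C :=
  fun i j => if Nat.eqb i j then Cminus (M i j) lam else M i j.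

Definition adjM (M : nat -> nat -> C) : nat -> nat -> C := fun i j => Cconj (M j i).

Definition Op := (nat -> C) -> (nat -> C).

Definition is_inverse (T B : Op) : Prop :=
  (forall y, l2 y -> l2 (B y)) /\
  (exists K : R, forall y, l2 y -> l2norm (B y) <= K * l2norm y) /\
  (forall y, l2 y -> T (B y) = y) /\
  (forall x, l2 x -> B (T x) = x).

Definition invertible (T : Op) : Prop := exists B, is_inverse T B.

Definition resnorm (T : Op) : Rbar :=
  match excluded_middle_informative (invertible T) with
  | left _ => Lub_Rbar (fun r => exists B, is_inverse T B /\
                 exists y, l2 y /\ l2norm y <= 1 /\ r = l2norm (B y))
  | right _ => p_infty
  end.

Definition spectrum (M : nat -> nat -> C) : C -> Prop :=
  fun lam => ~ invertible (matop (subId M lam)).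
Definition pseudospec (eps : R) (M : nat -> nat -> C) : C -> Prop :=
  fun lam => Rbar_lt (Finite (/ eps)) (resnorm (matop (subId M lam))).

Definition normalM (M : nat -> nat -> C) : Prop :=
  forall x, l2 x -> matop M (matop (adjM M) x) = matop (adjM M) (matop M x).

Definition dist_set (a : C) (B : C -> Prop) : Rbar :=
  Glb_Rbar (fun r => exists b, B b /\ r = Cmod (Cminus a b)).
Definition excess (A B : C -> Prop) : Rbar :=
  Lub_Rbar (fun r => exists a, A a /\ dist_set a B = Finite r).
Definition Rbar_max2 (x y : Rbar) : Rbar :=
  match excluded_middle_informative (Rbar_le x y) with left _ => y | right _ => x end.
Definition hausdorff (A B : C -> Prop) : Rbar :=
  match excluded_middle_informative (exists a, A a),
        excluded_middle_informative (exists b, B b) with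
  | left _, left _ => Rbar_max2 (excess A B) (excess B A)
  | right _, right _ => Finite 0
  | _, _ => p_infty
  end.

Definition Rbar_cvg (u : nat -> Rbar) (l : Rbar) : Prop :=
  match l with
  | Finite r => forall eps : posreal,
      eventually (fun n => exists x, u n = Finite x /\ Rabs (x - r) < eps)
  | p_infty => forall K : R, eventually (fun n => Rbar_lt (Finite K) (u n))
  | m_infty => forall K : R, eventually (fun n => Rbar_lt (u n) (Finite K))
  end.

(** Half-axis operator H(u)^+ = compression of L + S^gamma M_u to N.
    Lm : Z -> Z -> C is the matrix of L on ell^2(Z); u n stands for u(n+1).
    Paper entry (i,j), i,j>=1:  L_{ij} + [j = i - gamma] u(j). *)
Definition Hplus (Lm : Z -> Z -> C) (gamma : Z) (u : nat -> C) : nat -> nat -> C :=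
  fun i j => Cplus (Lm (Z.of_nat i + 1)%Z (Z.of_nat j + 1)%Z)
                   (if Z.eqb (Z.of_nat j) (Z.of_nat i - gamma)%Z then u j else RtoC 0).

Definition words (N : nat) (u : nat -> C) : list C -> Prop :=
  fun w => exists k : nat, w = map (fun i => u (k + i)%nat) (seq 0 N).

(* Main.v *)
(** A band matrix is bounded below by [e] on l2 as soon as it is almost so on all
    vectors supported in a window of some fixed length [N], because the averaged commutator
    of the matrix with a sliding window of length [N] is O(1/N). The columns seen by
    such a window depend only on a subword of the potential (or on a prefix of it, near the
    boundary), so the lower bounds of [A_m^+ - lam] and of its adjoint converge to
    those of [A^+ - lam], uniformly for [lam] in bounded sets; this is the convergence of the
    resolvent norms. For the pseudospectra one also needs that a resolvent norm close to
    [1 / eps] exceeds [1 / eps] at a nearby point, with constants depending only on the norm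
    of the operator. For normal operators the same local growth increases
    the resolvent norm geometrically along a sequence of geometrically decreasing steps,
    which therefore ends at a nearby point of the spectrum. *)

Require Import Defs.
From Stdlib Require Import Reals Lra Lia Psatz ZArith List.
From Stdlib Require Import Classical ClassicalEpsilon FunctionalExtensionality.
From Coquelicot Require Import Coquelicot.
Open Scope R_scope.

(** * Finite sums *)

(** Lower bounds replace inverses because a lower bound is tested on one vector at a time: a test
    vector can be cut into windows and transplanted, an inverse cannot. The transplanting is forced,
    since a subword of [b_m] may occur in [b] only at a distant position, so [A_m - A] need not be
    small in norm. The second obstacle is the strict inequality in [pseudospec]. Each transfer
    between [A_m] and [A] loses a little of the level, and if the resolvent norm could stay constant
    near the level 1/eps, the set could jump under such a loss. That it is not locally constant must
    be known uniformly in [m], so a qualitative maximum principle is not enough. A test vector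
    quadratic in the displacement z of the spectral parameter gives a gain of order |z|^2 against an
    error of order |z|^3, with explicit constants. The same gain shows that pseudospectra, and
    spectra of normal matrices, are nonempty, in place of Liouville's theorem. This matters because
    [hausdorff] is infinite as soon as exactly one of the two sets is empty. *)

Fixpoint psum (f : nat -> R) (n : nat) : R :=
  match n with O => 0 | S n => psum f n + f n end.

Lemma psum_ext f g n : (forall i, (i < n)%nat -> f i = g i) -> psum f n = psum g n.
Proof.
  induction n as [|n IH]; simpl; intros H; auto.
  rewrite IH, H; auto.
Qed.

Lemma psum_plus f g n : psum (fun i => f i + g i) n = psum f n + psum g n.
Proof. induction n as [|n IH]; simpl; [|rewrite IH]; lra. Qed.

Lemma psum_scal c f n : psum (fun i => c * f i) n = c * psum f n.
Proof. induction n as [|n IH]; simpl; [|rewrite IH]; lra. Qed.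

Lemma psum_le f g n : (forall i, (i < n)%nat -> f i <= g i) -> psum f n <= psum g n.
Proof.
  induction n as [|n IH]; simpl; intros H; [lra|].
  apply Rplus_le_compat; auto.
Qed.

Lemma psum_zero f n : (forall i, (i < n)%nat -> f i = 0) -> psum f n = 0.
Proof.
  induction n as [|n IH]; simpl; intros H; auto.
  rewrite IH, H; auto; lra.
Qed.

Lemma psum_nonneg f n : (forall i, (i < n)%nat -> 0 <= f i) -> 0 <= psum f n.
Proof.
  intros H. rewrite <- (psum_zero (fun _ => 0) n) by auto. now apply psum_le.
Qed.

Lemma psum_split f n m : psum f (n + m) = psum f n + psum (fun i => f (n + i)%nat) m.
Proof.
  induction m as [|m IH]; simpl; [rewrite Nat.add_0_r; lra|].
  rewrite Nat.add_succ_r; simpl. rewrite IH; lra.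
Qed.

Lemma psum_stable f n m :
  (n <= m)%nat -> (forall i, (n <= i)%nat -> f i = 0) -> psum f m = psum f n.
Proof.
  intros Hm H. replace m with (n + (m - n))%nat by lia.
  rewrite psum_split, (psum_zero (fun i => f (n + i)%nat)); [lra|].
  intros i _; apply H; lia.
Qed.

Lemma psum_mono f n m :
  (n <= m)%nat -> (forall i, 0 <= f i) -> psum f n <= psum f m.
Proof.
  intros Hm H. replace m with (n + (m - n))%nat by lia.
  rewrite psum_split.
  assert (0 <= psum (fun i => f (n + i)%nat) (m - n)) by (apply psum_nonneg; auto).
  lra.
Qed.

Lemma psum_exchange (f : nat -> nat -> R) n m :
  psum (fun i => psum (f i) m) n = psum (fun j => psum (fun i => f i j) n) m.
Proof.
  induction n as [|n IH]; simpl.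
  - symmetry; apply psum_zero; auto.
  - rewrite IH, <- psum_plus. reflexivity.
Qed.

Lemma psum_cauchy_schwarz f g n :
  (psum (fun i => f i * g i) n) ^ 2
  <= psum (fun i => f i ^ 2) n * psum (fun i => g i ^ 2) n.
Proof.
  induction n as [|n IH]; [simpl; lra|].
  set (a := psum (fun i => f i ^ 2) n) in *.
  set (b := psum (fun i => g i ^ 2) n) in *.
  set (c := psum (fun i => f i * g i) n) in *.
  cbn [psum]; fold a b c.
  assert (Ha : 0 <= a) by (apply psum_nonneg; intros; apply pow2_ge_0).
  assert (Hb : 0 <= b) by (apply psum_nonneg; intros; apply pow2_ge_0).
  (* The cross term is handled by the arithmetic-geometric mean inequality, since the induction
     hypothesis says [Rabs c <= sqrt a * sqrt b]. *)
  cut (2 * c * (f n * g n) <= a * g n ^ 2 + b * f n ^ 2); [nra|].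
  assert (H : Rabs c <= sqrt a * sqrt b).
  { rewrite <- sqrt_mult by auto. rewrite <- (sqrt_pow2 (Rabs c)) by apply Rabs_pos.
    apply sqrt_le_1_alt. now rewrite pow2_abs. }
  rewrite <- (sqrt_sqrt a), <- (sqrt_sqrt b) by auto.
  set (p := sqrt a) in *; set (q := sqrt b) in *.
  assert (2 * (c * (f n * g n)) <= 2 * (p * q * (Rabs (f n) * Rabs (g n)))).
  { apply Rmult_le_compat_l; [lra|].
    apply Rle_trans with (Rabs (c * (f n * g n))); [apply Rle_abs|].
    rewrite !Rabs_mult. apply Rmult_le_compat_r; auto.
    apply Rmult_le_pos; apply Rabs_pos. }
  assert (0 <= (p * Rabs (g n) - q * Rabs (f n)) ^ 2) by apply pow2_ge_0.
  rewrite <- (pow2_abs (f n)), <- (pow2_abs (g n)).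
  nra.
Qed.

(** Real-valued, so that it serves as a weight in sums. Since subtraction in [nat] stops at 0, the
    interval from [i - W] to [i + W + 1] is the set of columns of a band row also near the boundary
    of the half axis. *)
Definition indic (a b k : nat) : R := if (Nat.leb a k && Nat.ltb k b)%bool then 1 else 0.
Arguments indic (a b k)%_nat_scope.

Lemma indic_cases a b k :
  ((a <= k < b)%nat /\ indic a b k = 1) \/ (~ (a <= k < b)%nat /\ indic a b k = 0).
Proof.
  unfold indic. destruct (Nat.leb_spec a k), (Nat.ltb_spec k b); simpl;
    [left|right..]; (split; [lia|reflexivity]).
Qed.

Lemma indic_nonneg a b k : 0 <= indic a b k.
Proof. destruct (indic_cases a b k) as [[_ ->]|[_ ->]]; lra. Qed.

Lemma psum_indic a b n : psum (indic a b) n = INR (Nat.min n b - a).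
Proof.
  induction n as [|n IH]; [reflexivity|].
  cbn [psum]; rewrite IH.
  destruct (indic_cases a b n) as [[H ->]|[H ->]].
  - replace (Nat.min (S n) b - a)%nat with (S (Nat.min n b - a)) by lia.
    now rewrite S_INR.
  - rewrite Rplus_0_r; f_equal; lia.
Qed.

Lemma psum_indic_le a b n : psum (indic a b) n <= INR (b - a).
Proof. rewrite psum_indic. apply le_INR; lia. Qed.

Definition csum (f : nat -> C) (n : nat) : C :=
  (psum (fun i => fst (f i)) n, psum (fun i => snd (f i)) n).

Lemma csum_ext f g n : (forall i, (i < n)%nat -> f i = g i) -> csum f n = csum g n.
Proof. intros H; unfold csum; f_equal; apply psum_ext; intros; now rewrite H. Qed.

Lemma csum_plus f g n : csum (fun i => Cplus (f i) (g i)) n = Cplus (csum f n) (csum g n).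
Proof. unfold csum, Cplus; simpl; f_equal; apply psum_plus. Qed.

Lemma csum_scal c f n : csum (fun i => Cmult c (f i)) n = Cmult c (csum f n).
Proof.
  unfold csum, Cmult; simpl; f_equal.
  - unfold Rminus; rewrite Ropp_mult_distr_l, <- !psum_scal, <- psum_plus.
    apply psum_ext; intros; lra.
  - rewrite <- !psum_scal, <- psum_plus. apply psum_ext; intros; lra.
Qed.

Lemma csum_zero f n : (forall i, (i < n)%nat -> f i = RtoC 0) -> csum f n = RtoC 0.
Proof. intros H; unfold csum, RtoC; f_equal; apply psum_zero; intros; now rewrite H. Qed.

Lemma csum_split f n m : csum f (n + m) = Cplus (csum f n) (csum (fun i => f (n + i)%nat) m).
Proof. unfold csum, Cplus; simpl; f_equal; apply psum_split. Qed.

Lemma Cmod_csum f n : Cmod (csum f n) <= psum (fun i => Cmod (f i)) n.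
Proof.
  induction n as [|n IH].
  - unfold csum; simpl. fold (RtoC 0). rewrite Cmod_0; lra.
  - replace (csum f (S n)) with (Cplus (csum f n) (f n)) by reflexivity.
    eapply Rle_trans; [apply Cmod_triangle|]. simpl; lra.
Qed.

(** * The Hilbert space of square-summable sequences *)

Definition cdot (z w : C) : R := fst z * fst w + snd z * snd w.

Lemma Cmod_sqr z : Cmod z ^ 2 = cdot z z.
Proof.
  unfold Cmod, cdot. rewrite pow2_sqrt; [ring|].
  generalize (pow2_ge_0 (fst z)) (pow2_ge_0 (snd z)); lra.
Qed.

Lemma is_series_psum (f : nat -> R) l :
  is_series f l <-> is_lim_seq (psum f) l.
Proof.
  rewrite (is_lim_seq_incr_1 (psum f) l).
  assert (E : forall n, sum_n f n = psum f (S n)).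
  { induction n as [|n IH]; [rewrite sum_O; simpl; ring|].
    rewrite sum_Sn, IH. reflexivity. }
  split; intros H.
  - apply (is_lim_seq_ext (sum_n f)); [exact E|exact H].
  - apply (is_lim_seq_ext _ (sum_n f)) in H; [exact H|now intros; rewrite E].
Qed.

Lemma is_series_finite f n :
  (forall i, (n <= i)%nat -> f i = 0) -> is_series f (psum f n).
Proof.
  intros H. apply is_series_psum.
  apply is_lim_seq_ext_loc with (fun _ => psum f n); [|apply is_lim_seq_const].
  exists n; intros m Hm. now rewrite (psum_stable f n m).
Qed.

Lemma Series_finite f n : (forall i, (n <= i)%nat -> f i = 0) -> Series f = psum f n.
Proof. intros; now apply is_series_unique, is_series_finite. Qed.

Lemma series_bounded f M :
  (forall i, 0 <= f i) -> (forall n, psum f n <= M) -> ex_series f /\ Series f <= M.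
Proof.
  intros Hf HM.
  assert (Hl : ex_finite_lim_seq (psum f)).
  { apply ex_finite_lim_seq_incr with M; auto.
    intros n; simpl; specialize (Hf n); lra. }
  destruct Hl as [l Hl].
  assert (Hs : is_series f l) by now apply is_series_psum.
  split; [now exists l|].
  rewrite (is_series_unique _ _ Hs).
  apply (is_lim_seq_le (psum f) (fun _ => M) l M HM Hl), is_lim_seq_const.
Qed.

Lemma psum_le_Series f n : (forall i, 0 <= f i) -> ex_series f -> psum f n <= Series f.
Proof.
  intros Hf Hs.
  apply Series_correct, is_series_psum in Hs.
  apply (is_lim_seq_le_loc (fun _ => psum f n) (psum f) (psum f n) (Series f));
    [|apply is_lim_seq_const|exact Hs].
  exists n; intros m Hm; now apply psum_mono.
Qed.

Definition nsq (x : nat -> C) : R := Series (fun n => Cmod (x n) ^ 2).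
(** The real part of the complex inner product. It determines norms and adjoints; only real scalars
    can be pulled out, complex ones are moved across by conjugation. *)
Definition ip (x y : nat -> C) : R := Series (fun n => cdot (x n) (y n)).
Definition vadd (x y : nat -> C) : nat -> C := fun n => Cplus (x n) (y n).
Definition vscal (c : C) (x : nat -> C) : nat -> C := fun n => Cmult c (x n).
Definition vzero : nat -> C := fun _ => RtoC 0.

Lemma l2_bounded x M :
  (forall n, psum (fun i => Cmod (x i) ^ 2) n <= M) -> l2 x /\ nsq x <= M.
Proof. intros H; apply series_bounded; auto; intros; apply pow2_ge_0. Qed.

Lemma psum_le_nsq x n : l2 x -> psum (fun i => Cmod (x i) ^ 2) n <= nsq x.
Proof. intros H; apply psum_le_Series; auto; intros; apply pow2_ge_0. Qed.

Lemma nsq_nonneg x : l2 x -> 0 <= nsq x.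
Proof. intros H; apply (psum_le_nsq x 0 H). Qed.

Lemma Cmod_le_nsq x n : l2 x -> Cmod (x n) ^ 2 <= nsq x.
Proof.
  intros H. apply Rle_trans with (2 := psum_le_nsq x (S n) H). simpl.
  assert (0 <= psum (fun i => Cmod (x i) ^ 2) n)
    by (apply psum_nonneg; intros; apply pow2_ge_0).
  simpl in *; lra.
Qed.

Lemma nsq_ip x : nsq x = ip x x.
Proof. apply Series_ext; intros; apply Cmod_sqr. Qed.

Lemma cdot_bound z w : Rabs (cdot z w) <= / 2 * (Cmod z ^ 2 + Cmod w ^ 2).
Proof.
  rewrite !Cmod_sqr; destruct z as [a b], w as [c d]; unfold cdot; simpl.
  apply Rabs_le; split;
    generalize (pow2_ge_0 (a - c)) (pow2_ge_0 (b - d)) (pow2_ge_0 (a + c)) (pow2_ge_0 (b + d)); nra.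
Qed.

Lemma ex_series_cdot x y : l2 x -> l2 y -> ex_series (fun n => cdot (x n) (y n)).
Proof.
  intros Hx Hy.
  apply (ex_series_le (V := R_CompleteNormedModule) _ (fun n => / 2 * (Cmod (x n) ^ 2 + Cmod (y n) ^ 2))).
  - intros n; apply cdot_bound.
  - apply (ex_series_scal (V := R_NormedModule)), (ex_series_plus (V := R_NormedModule)); auto.
Qed.

Lemma l2_vadd x y : l2 x -> l2 y -> l2 (vadd x y).
Proof.
  intros Hx Hy. unfold l2.
  apply (ex_series_ext (fun n => (Cmod (x n) ^ 2 + Cmod (y n) ^ 2) + 2 * cdot (x n) (y n))).
  - intros n; rewrite !Cmod_sqr; unfold vadd, cdot; simpl; ring.
  - apply (ex_series_plus (V := R_NormedModule)).
    + now apply (ex_series_plus (V := R_NormedModule)).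
    + now apply (ex_series_scal (V := R_NormedModule)), ex_series_cdot.
Qed.

Lemma l2_vscal c x : l2 x -> l2 (vscal c x).
Proof.
  intros Hx. unfold l2.
  apply (ex_series_ext (fun n => Cmod c ^ 2 * Cmod (x n) ^ 2)).
  - intros n; unfold vscal; rewrite Cmod_mult; simpl; ring.
  - now apply (ex_series_scal (V := R_NormedModule)).
Qed.

Lemma nsq_vscal c x : nsq (vscal c x) = Cmod c ^ 2 * nsq x.
Proof.
  unfold nsq; rewrite <- Series_scal_l; apply Series_ext; intros n.
  unfold vscal; rewrite Cmod_mult; ring.
Qed.

Lemma ip_sym x y : ip x y = ip y x.
Proof. apply Series_ext; intros; unfold cdot; ring. Qed.

Lemma ip_vadd_l x y z : l2 x -> l2 y -> l2 z -> ip (vadd x y) z = ip x z + ip y z.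
Proof.
  intros; unfold ip; rewrite <- Series_plus by now apply ex_series_cdot.
  apply Series_ext; intros; unfold cdot, vadd; simpl; ring.
Qed.

Lemma ip_vadd_r x y z : l2 x -> l2 y -> l2 z -> ip z (vadd x y) = ip z x + ip z y.
Proof. intros; rewrite ip_sym, ip_vadd_l, (ip_sym x), (ip_sym y); auto. Qed.

Lemma ip_vscal_conj c x y : ip (vscal c x) y = ip x (vscal (Cconj c) y).
Proof. apply Series_ext; intros; unfold cdot, vscal; simpl; ring. Qed.

Lemma ip_vscal_l (r : R) x y : ip (vscal (RtoC r) x) y = r * ip x y.
Proof.
  unfold ip; rewrite <- Series_scal_l.
  apply Series_ext; intros; unfold cdot, vscal; simpl; ring.
Qed.

Lemma ip_vscal_r (r : R) x y : ip x (vscal (RtoC r) y) = r * ip x y.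
Proof. rewrite ip_sym, ip_vscal_l, ip_sym; auto. Qed.

Lemma nsq_vadd x y : l2 x -> l2 y -> nsq (vadd x y) = nsq x + 2 * ip x y + nsq y.
Proof.
  intros Hx Hy. rewrite !nsq_ip, ip_vadd_l, !ip_vadd_r, (ip_sym y x); auto using l2_vadd. ring.
Qed.

Lemma l2norm_sqr x : l2 x -> l2norm x ^ 2 = nsq x.
Proof. intros H; apply pow2_sqrt, nsq_nonneg, H. Qed.

Lemma l2norm_nonneg x : 0 <= l2norm x.
Proof. apply sqrt_pos. Qed.

Lemma ip_le_norms x y : l2 x -> l2 y -> ip x y <= l2norm x * l2norm y.
Proof.
  intros Hx Hy.
  assert (H : forall a b : R, 0 <= a ^ 2 * nsq x + 2 * (a * b) * ip x y + b ^ 2 * nsq y).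
  { intros a b.
    generalize (nsq_nonneg _ (l2_vadd _ _ (l2_vscal (RtoC a) _ Hx) (l2_vscal (RtoC b) _ Hy))).
    rewrite nsq_vadd, ip_vscal_l, ip_vscal_r, !nsq_vscal, !Cmod_R, !pow2_abs by auto using l2_vscal.
    lra. }
  rewrite <- !l2norm_sqr in H by auto.
  set (p := l2norm x) in *; set (q := l2norm y) in *.
  assert (Hp : 0 <= p) by apply l2norm_nonneg. assert (Hq : 0 <= q) by apply l2norm_nonneg.
  (* The usual choice [a = q], [b = - p] only works if both norms are nonzero. If one of them
     vanishes, the form is made negative by the multiplier [ip x y] on the other vector and a large
     negative one on the vector of norm 0. *)
  destruct (Req_dec p 0) as [Ep|Ep].
  - apply Rnot_lt_le; intros Hc. rewrite Ep in *.
    specialize (H (- (q ^ 2 + 1)) (ip x y)). nra.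
  - destruct (Req_dec q 0) as [Eq|Eq].
    + apply Rnot_lt_le; intros Hc. rewrite Eq in *.
      specialize (H (ip x y) (- (p ^ 2 + 1))). nra.
    + specialize (H q (- p)).
      assert (0 < p * q) by (apply Rmult_lt_0_compat; lra).
      nra.
Qed.

Lemma l2norm_vadd x y : l2 x -> l2 y -> l2norm (vadd x y) <= l2norm x + l2norm y.
Proof.
  intros Hx Hy.
  apply Rsqr_incr_0_var;
    [|generalize (l2norm_nonneg x) (l2norm_nonneg y); lra].
  rewrite !Rsqr_pow2, l2norm_sqr, nsq_vadd by auto using l2_vadd.
  generalize (ip_le_norms x y Hx Hy) (l2norm_sqr x Hx) (l2norm_sqr y Hy). nra.
Qed.

Lemma l2norm_vscal c x : l2 x -> l2norm (vscal c x) = Cmod c * l2norm x.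
Proof.
  intros Hx. unfold l2norm; fold (nsq (vscal c x)) (nsq x).
  rewrite nsq_vscal, sqrt_mult, sqrt_pow2; auto using nsq_nonneg, Cmod_ge_0, pow2_ge_0.
Qed.

Lemma nsq_le_l2norm x y a : l2 x -> l2 y -> 0 <= a ->
  nsq x <= a ^ 2 * nsq y <-> l2norm x <= a * l2norm y.
Proof.
  intros Hx Hy Ha. rewrite <- !l2norm_sqr by auto.
  generalize (l2norm_nonneg x) (l2norm_nonneg y).
  generalize (l2norm x) (l2norm y); intros p q Hp Hq; split; intros H.
  - apply Rsqr_incr_0_var; [unfold Rsqr|apply Rmult_le_pos; auto]. nra.
  - rewrite <- Rpow_mult_distr. apply pow_incr; lra.
Qed.

Lemma l2_vzero : l2 vzero.
Proof.
  apply (l2_bounded vzero 0). intros n; rewrite psum_zero; [lra|].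
  intros; unfold vzero; rewrite Cmod_0; ring.
Qed.

Lemma nsq_vzero : nsq vzero = 0.
Proof.
  unfold nsq; rewrite (Series_finite _ 0); [reflexivity|].
  intros; unfold vzero; rewrite Cmod_0; ring.
Qed.

Lemma nsq_zero_inv x : l2 x -> nsq x <= 0 -> x = vzero.
Proof.
  intros Hx H; apply functional_extensionality; intros n.
  apply Cmod_eq_0.
  generalize (Cmod_le_nsq x n Hx) (Cmod_ge_0 (x n)). intros; nra.
Qed.

(** * Truncation to windows and density of finitely supported vectors *)

Definition supported (a b : nat) (x : nat -> C) : Prop :=
  forall n, ~ (a <= n < b)%nat -> x n = RtoC 0.

Definition restrict (a b : nat) (x : nat -> C) : nat -> C :=
  fun n => if (Nat.leb a n && Nat.ltb n b)%bool then x n else RtoC 0.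

Arguments supported (a b)%_nat_scope x.
Arguments restrict (a b)%_nat_scope x n%_nat_scope.

Lemma restrict_cases a b x n :
  ((a <= n < b)%nat /\ restrict a b x n = x n)
  \/ (~ (a <= n < b)%nat /\ restrict a b x n = RtoC 0).
Proof.
  unfold restrict. destruct (Nat.leb_spec a n), (Nat.ltb_spec n b); simpl;
    [left|right..]; (split; [lia|reflexivity]).
Qed.

Lemma supported_restrict a b x : supported a b (restrict a b x).
Proof. intros n Hn. destruct (restrict_cases a b x n) as [[? _]|[_ ->]]; tauto. Qed.

Lemma nsq_supported a b x : supported a b x -> nsq x = psum (fun i => Cmod (x i) ^ 2) b.
Proof.
  intros H; unfold nsq; apply Series_finite.
  intros i Hi; rewrite H by lia. rewrite Cmod_0; ring.
Qed.

Lemma l2_supported a b x : supported a b x -> l2 x.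
Proof.
  intros H; exists (psum (fun i => Cmod (x i) ^ 2) b); apply (is_series_finite (fun i => Cmod (x i) ^ 2)).
  intros i Hi; rewrite H by lia. rewrite Cmod_0; ring.
Qed.

(** Truncation is an orthogonal projection, so the squared norm of the tail is [nsq x] minus a
    partial sum of its series. *)
Lemma tail_small x eps : l2 x -> 0 < eps ->
  exists n, nsq (vadd x (vscal (RtoC (-1)) (restrict 0 n x))) < eps.
Proof.
  intros Hx He.
  assert (Hs := Series_correct _ Hx). apply is_series_psum in Hs.
  apply is_lim_seq_spec in Hs. destruct (Hs (mkposreal eps He)) as [n Hn].
  specialize (Hn n (le_n n)). fold (nsq x) in Hn. cbn [pos] in Hn.
  exists n.
  assert (Hr := supported_restrict 0 n x).
  assert (Hr2 : l2 (restrict 0 n x)) by exact (l2_supported _ _ _ Hr).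
  rewrite nsq_vadd, nsq_vscal, ip_vscal_r by auto using l2_vscal.
  assert (E : ip x (restrict 0 n x) = nsq (restrict 0 n x)).
  { apply Series_ext; intros i; rewrite Cmod_sqr.
    destruct (restrict_cases 0 n x i) as [[_ ->]|[_ ->]]; unfold cdot; simpl; ring. }
  rewrite E, Cmod_R, pow2_abs.
  replace (nsq (restrict 0 n x)) with (psum (fun i => Cmod (x i) ^ 2) n).
  { apply Rabs_def2 in Hn. lra. }
  rewrite (nsq_supported _ _ _ Hr). apply psum_ext; intros i Hi.
  destruct (restrict_cases 0 n x i) as [[_ ->]|[? _]]; [reflexivity|lia].
Qed.

(** * Band matrices as operators *)

(** One inequality encodes both the width and the uniform bound on the entries, so norm estimates
    reduce to counting with indicators. *)
Definition band (W : nat) (K : R) (M : nat -> nat -> C) : Prop :=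
  0 <= K /\ forall i j, Cmod (M i j) <= K * indic (i - W) (i + W + 1) j.

Lemma indic_band_sym W i j : indic (i - W) (i + W + 1) j = indic (j - W) (j + W + 1) i.
Proof.
  destruct (indic_cases (i - W) (i + W + 1) j) as [[? ->]|[? ->]],
    (indic_cases (j - W) (j + W + 1) i) as [[? ->]|[? ->]]; auto; lia.
Qed.

Lemma band_zero W K M i j : band W K M -> ~ (i - W <= j < i + W + 1)%nat -> M i j = RtoC 0.
Proof.
  intros [_ HM] H. apply Cmod_eq_0. specialize (HM i j).
  destruct (indic_cases (i - W) (i + W + 1) j) as [[? _]|[_ E]]; [tauto|].
  rewrite E, Rmult_0_r in HM. generalize (Cmod_ge_0 (M i j)); lra.
Qed.

Lemma band_adjM W K M : band W K M -> band W K (adjM M).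
Proof.
  intros [HK HM]; split; auto. intros i j; unfold adjM.
  rewrite Cmod_conj, indic_band_sym; auto.
Qed.

Lemma band_subId W K M lam : band W K M -> band W (K + Cmod lam) (subId M lam).
Proof.
  intros [HK HM]; split; [generalize (Cmod_ge_0 lam); lra|].
  intros i j; unfold subId.
  destruct (Nat.eqb_spec i j) as [<-|Hij].
  - specialize (HM i i).
    destruct (indic_cases (i - W) (i + W + 1) i) as [[_ E]|[? _]]; [|lia].
    rewrite E in *. unfold Cminus. eapply Rle_trans; [apply Cmod_triangle|].
    rewrite Cmod_opp; lra.
  - eapply Rle_trans; [apply HM|]. apply Rmult_le_compat_r; [apply indic_nonneg|].
    generalize (Cmod_ge_0 lam); lra.
Qed.

Lemma adjM_involutive M : adjM (adjM M) = M.
Proof.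
  apply functional_extensionality; intros i; apply functional_extensionality; intros j.
  apply Cconj_conj.
Qed.

Lemma adjM_subId M lam : adjM (subId M lam) = subId (adjM M) (Cconj lam).
Proof.
  apply functional_extensionality; intros i; apply functional_extensionality; intros j.
  unfold adjM, subId. rewrite Nat.eqb_sym.
  destruct (Nat.eqb i j); auto. now rewrite Cminus_conj.
Qed.

Lemma matop_csum M x i n :
  (forall j, (n <= j)%nat -> Cmult (M i j) (x j) = RtoC 0) ->
  matop M x i = csum (fun j => Cmult (M i j) (x j)) n.
Proof.
  intros H; unfold matop, csum; f_equal; apply Series_finite; intros j Hj; now rewrite H.
Qed.

Lemma matop_band W K M x i n : band W K M -> (i + W + 1 <= n)%nat ->
  matop M x i = csum (fun j => Cmult (M i j) (x j)) n.
Proof.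
  intros HM Hn; apply matop_csum; intros j Hj.
  rewrite (band_zero W K) by (auto; lia). apply Cmult_0_l.
Qed.

(** Rows of a band matrix are finite, so linearity holds on all sequences, without any
    summability. *)
Lemma matop_vadd W K M x y : band W K M ->
  matop M (vadd x y) = vadd (matop M x) (matop M y).
Proof.
  intros HM; apply functional_extensionality; intros i; unfold vadd.
  rewrite !(matop_band W K M _ i (i + W + 1) HM) by lia.
  rewrite <- csum_plus; apply csum_ext; intros; apply Cmult_plus_distr_l.
Qed.

Lemma matop_vscal W K M c x : band W K M -> matop M (vscal c x) = vscal c (matop M x).
Proof.
  intros HM; apply functional_extensionality; intros i; unfold vscal.
  rewrite !(matop_band W K M _ i (i + W + 1) HM) by lia.
  rewrite <- csum_scal; apply csum_ext; intros.
  rewrite !Cmult_assoc, (Cmult_comm c); reflexivity.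
Qed.

Lemma matop_subId W K M lam x : band W K M ->
  matop (subId M lam) x = vadd (matop M x) (vscal (Copp lam) x).
Proof.
  intros HM; apply functional_extensionality; intros i; unfold vadd, vscal.
  rewrite (matop_band W _ _ _ i (i + W + 1) (band_subId W K M lam HM)) by lia.
  rewrite (matop_band W K M _ i (i + W + 1) HM) by lia.
  (* The row is cut into the part left of the diagonal, the diagonal entry, and the [W] entries to
     its right; only the middle one feels [lam]. *)
  replace (i + W + 1)%nat with (i + S W)%nat by lia.
  rewrite !csum_split.
  assert (E : forall f, csum f (S W) = Cplus (f O) (csum (fun j => f (S j)) W)).
  { intros f; change (S W) with (1 + W)%nat; rewrite csum_split. f_equal.
    unfold csum; simpl. rewrite !Rplus_0_l. now destruct (f O). }
  rewrite !E, Nat.add_0_r.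
  rewrite (csum_ext (fun j => Cmult (subId M lam i j) (x j)) (fun j => Cmult (M i j) (x j))).
  2:{ intros j Hj; unfold subId; destruct (Nat.eqb_spec i j); [lia|auto]. }
  rewrite (csum_ext (fun j => Cmult (subId M lam i (i + S j)) (x (i + S j)%nat))
                    (fun j => Cmult (M i (i + S j)%nat) (x (i + S j)%nat))).
  2:{ intros j Hj; unfold subId; destruct (Nat.eqb_spec i (i + S j)); [lia|auto]. }
  unfold subId at 1; rewrite Nat.eqb_refl. ring.
Qed.

Lemma psum_indic_cauchy_schwarz a b g n :
  (psum (fun j => indic a b j * g j) n) ^ 2
  <= INR (b - a) * psum (fun j => indic a b j * g j ^ 2) n.
Proof.
  assert (E : forall j, indic a b j * indic a b j = indic a b j).
  { intros j; destruct (indic_cases a b j) as [[_ ->]|[_ ->]]; ring. }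
  rewrite (psum_ext _ (fun j => indic a b j * (indic a b j * g j)))
    by (intros; rewrite <- Rmult_assoc, E; auto).
  eapply Rle_trans; [apply psum_cauchy_schwarz|].
  rewrite (psum_ext (fun i => indic a b i ^ 2) (indic a b)) by (intros; rewrite <- (E i) at 2; ring).
  rewrite (psum_ext (fun i => (indic a b i * g i) ^ 2) (fun j => indic a b j * g j ^ 2))
    by (intros; rewrite <- (E i) at 2; ring).
  apply Rmult_le_compat_r; [|apply psum_indic_le].
  apply psum_nonneg; intros; apply Rmult_le_pos; [apply indic_nonneg|apply pow2_ge_0].
Qed.

(** Cauchy-Schwarz over at most [2 * W + 1] entries. The indicator stays inside the sum because the
    estimate is later summed over [i], where it counts rows per column. *)
Lemma band_row_bound W K M y i n : band W K M ->
  Cmod (csum (fun j => Cmult (M i j) (y j)) n) ^ 2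
  <= K ^ 2 * INR (2 * W + 1) * psum (fun j => indic (i - W) (i + W + 1) j * Cmod (y j) ^ 2) n.
Proof.
  intros [HK HM].
  assert (H1 : Cmod (csum (fun j => Cmult (M i j) (y j)) n)
    <= K * psum (fun j => indic (i - W) (i + W + 1) j * Cmod (y j)) n).
  { eapply Rle_trans; [apply Cmod_csum|]. rewrite <- psum_scal; apply psum_le; intros j _.
    rewrite Cmod_mult, <- Rmult_assoc. apply Rmult_le_compat_r; [apply Cmod_ge_0|apply HM]. }
  eapply Rle_trans; [apply pow_incr; split; [apply Cmod_ge_0|exact H1]|].
  rewrite Rpow_mult_distr, Rmult_assoc. apply Rmult_le_compat_l; [apply pow2_ge_0|].
  eapply Rle_trans; [apply psum_indic_cauchy_schwarz|].
  apply Rmult_le_compat_r; [|apply le_INR; lia].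
  apply psum_nonneg; intros; apply Rmult_le_pos; [apply indic_nonneg|apply pow2_ge_0].
Qed.

Lemma psum_band_sum W (f : nat -> R) n m : (forall j, 0 <= f j) ->
  psum (fun i => psum (fun j => indic (i - W) (i + W + 1) j * f j) m) n
  <= INR (2 * W + 1) * psum f m.
Proof.
  intros Hf. rewrite psum_exchange, <- psum_scal. apply psum_le; intros j _.
  rewrite (psum_ext _ (fun i => f j * indic (j - W) (j + W + 1) i))
    by (intros; rewrite indic_band_sym; ring).
  rewrite psum_scal, Rmult_comm. apply Rmult_le_compat_r; auto.
  eapply Rle_trans; [apply psum_indic_le|]. apply le_INR; lia.
Qed.

(** The sum of the bounds of the [2 * W + 1] diagonals; it dominates the operator norm and is shared
    by all matrices of the same band class. *)
Definition opbound (W : nat) (K : R) : R := K * INR (2 * W + 1).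

Lemma opbound_nonneg W K M : band W K M -> 0 <= opbound W K.
Proof. intros [H _]; apply Rmult_le_pos; [auto|apply pos_INR]. Qed.

Lemma band_bounded W K M x : band W K M -> l2 x ->
  l2 (matop M x) /\ nsq (matop M x) <= opbound W K ^ 2 * nsq x.
Proof.
  intros HM Hx; apply l2_bounded; intros n.
  set (m := (n + W + 1)%nat).
  eapply Rle_trans.
  - apply psum_le; intros i Hi. rewrite (matop_band W K M x i m HM) by (unfold m; lia).
    apply (band_row_bound W K M x i m HM).
  - rewrite psum_scal. unfold opbound.
    generalize (psum_band_sum W (fun j => Cmod (x j) ^ 2) n m (fun j => pow2_ge_0 _)).
    generalize (psum_le_nsq x m Hx). cbn beta.
    set (a := psum (fun i => psum _ m) n). set (c := psum _ m). intros H1 H2.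
    rewrite Rpow_mult_distr, !Rmult_assoc. apply Rmult_le_compat_l; [apply pow2_ge_0|].
    simpl pow; rewrite Rmult_1_r, Rmult_assoc. apply Rmult_le_compat_l; [apply pos_INR|].
    eapply Rle_trans; [exact H2|]. apply Rmult_le_compat_l; [apply pos_INR|auto].
Qed.

Lemma l2_matop W K M x : band W K M -> l2 x -> l2 (matop M x).
Proof. intros; eapply band_bounded; eauto. Qed.

Lemma l2norm_matop W K M x : band W K M -> l2 x ->
  l2norm (matop M x) <= opbound W K * l2norm x.
Proof.
  intros HM Hx. destruct (band_bounded W K M x HM Hx) as [H1 H2].
  apply nsq_le_l2norm; auto. now apply opbound_nonneg with M.
Qed.

Lemma Rabs_ip_le x y : l2 x -> l2 y -> Rabs (ip x y) <= l2norm x * l2norm y.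
Proof.
  intros Hx Hy. apply Rabs_le; split; [|now apply ip_le_norms].
  generalize (ip_le_norms (vscal (RtoC (-1)) x) y (l2_vscal _ _ Hx) Hy).
  rewrite ip_vscal_l, l2norm_vscal, Cmod_R by auto.
  rewrite Rabs_left by lra. lra.
Qed.

Lemma psum_cdot_csum_l f y n m :
  psum (fun i => cdot (csum (f i) m) (y i)) n = psum (fun i => psum (fun j => cdot (f i j) (y i)) m) n.
Proof.
  apply psum_ext; intros i _. unfold cdot, csum; simpl.
  rewrite psum_plus, !(Rmult_comm (psum _ m)), <- !psum_scal.
  f_equal; apply psum_ext; intros; ring.
Qed.

(** With [x] finitely supported, both sides are finite double sums over rows below [n + W + 1] and
    columns below [n], and the order of summation can be exchanged. *)
Lemma ip_matop_supported W K M x y n : band W K M -> supported 0 n x ->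
  ip (matop M x) y = ip x (matop (adjM M) y).
Proof.
  intros HM Hx. set (m := (n + W + 1)%nat).
  assert (E1 : forall i, matop M x i = csum (fun j => Cmult (M i j) (x j)) n).
  { intros i; apply matop_csum; intros j Hj; rewrite Hx by lia; apply Cmult_0_r. }
  unfold ip. rewrite (Series_finite _ m), (Series_finite _ n).
  - rewrite (psum_ext _ (fun i => cdot (csum (fun j => Cmult (M i j) (x j)) n) (y i)))
      by (intros; now rewrite E1).
    rewrite psum_cdot_csum_l, psum_exchange.
    rewrite (psum_ext (fun i => cdot (x i) _)
      (fun j => cdot (csum (fun i => Cmult (adjM M j i) (y i)) m) (x j))).
    2:{ intros j Hj. rewrite (matop_band W K _ _ _ m (band_adjM _ _ _ HM)) by (unfold m; lia).
        unfold cdot; ring. }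
    rewrite psum_cdot_csum_l. apply psum_ext; intros j _; apply psum_ext; intros i _.
    unfold cdot, adjM; simpl; ring.
  - intros i Hi; rewrite Hx by lia. unfold cdot; simpl; ring.
  - intros i Hi. rewrite E1, csum_zero; [unfold cdot; simpl; ring|].
    intros j Hj. rewrite (band_zero W K M i j HM) by (unfold m in Hi; lia). apply Cmult_0_l.
Qed.

Lemma Rle_of_lt_all a b : (forall e, 0 < e -> a <= b + e) -> a <= b.
Proof.
  intros H; apply Rnot_lt_le; intros Hab. specialize (H ((a - b) / 2)). lra.
Qed.

Lemma ip_matop W K M x y : band W K M -> l2 x -> l2 y ->
  ip (matop M x) y = ip x (matop (adjM M) y).
Proof.
  intros HM Hx Hy. apply Rminus_diag_uniq.
  set (k := opbound W K).
  assert (Hk : 0 <= k) by now apply opbound_nonneg with M.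
  cut (Rabs (ip (matop M x) y - ip x (matop (adjM M) y)) <= 0).
  { intros H; apply Rabs_eq_0; generalize (Rabs_pos (ip (matop M x) y - ip x (matop (adjM M) y))); lra. }
  apply Rle_of_lt_all; intros e He; rewrite Rplus_0_l.
  (* After splitting [x] into a truncation [r] and a tail [t], each of the two error terms is at
     most [k * l2norm t * l2norm y]; the added 1 makes [B] a legitimate divisor. *)
  set (B := 2 * k * l2norm y + 1).
  assert (HB : 0 < B) by (generalize (Rmult_le_pos _ _ Hk (l2norm_nonneg y)); unfold B; lra).
  destruct (tail_small x ((e / B) ^ 2) Hx) as [n Hn].
  { apply pow_lt, Rdiv_lt_0_compat; auto. }
  set (t := vadd x _) in Hn. set (r := restrict 0 n x).
  assert (Hr : l2 r) by (eapply l2_supported, supported_restrict).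
  assert (Ht : l2 t) by (apply l2_vadd; auto using l2_vscal).
  assert (Ex : x = vadd t r).
  { apply functional_extensionality; intros i; unfold t, r, vadd, vscal.
    apply injective_projections; simpl; ring. }
  assert (HMs := band_adjM _ _ _ HM).
  rewrite Ex at 1 2. rewrite (matop_vadd W K) by auto.
  rewrite !ip_vadd_l by eauto using l2_matop.
  rewrite (ip_matop_supported W K M r y n HM) by apply supported_restrict.
  replace (_ - _) with (ip (matop M t) y - ip t (matop (adjM M) y)) by ring.
  assert (Hnt : l2norm t <= e / B).
  { rewrite <- (sqrt_pow2 (e / B)) by (apply Rlt_le, Rdiv_lt_0_compat; auto).
    apply sqrt_le_1_alt; fold (nsq t); lra. }
  eapply Rle_trans; [apply Rabs_triang|]. rewrite Rabs_Ropp.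
  eapply Rle_trans; [apply Rplus_le_compat; apply Rabs_ip_le; eauto using l2_matop|].
  generalize (l2norm_matop W K M t HM Ht) (l2norm_matop W K _ y HMs Hy) (l2norm_nonneg t) (l2norm_nonneg y).
  fold k. intros H1 H2 H3 H4.
  assert (l2norm (matop M t) * l2norm y <= k * l2norm t * l2norm y) by now apply Rmult_le_compat_r.
  assert (l2norm t * l2norm (matop (adjM M) y) <= l2norm t * (k * l2norm y)) by now apply Rmult_le_compat_l.
  apply Rle_trans with (B * l2norm t); [unfold B; nra|].
  apply Rle_trans with (B * (e / B)); [apply Rmult_le_compat_l; lra|].
  right; field; lra.
Qed.

(** * Lower bounds and invertibility *)

(** The constant refers to squared norms, so that squares of entries can be summed directly; a bound
    [e] for norms is [d = e ^ 2]. *)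
Definition lower_bound (M : nat -> nat -> C) (d : R) : Prop :=
  forall x, l2 x -> d * nsq x <= nsq (matop M x).

Definition cvg_pointwise (X : nat -> nat -> C) (x : nat -> C) : Prop :=
  forall i, is_lim_seq (fun n => fst (X n i)) (fst (x i))
         /\ is_lim_seq (fun n => snd (X n i)) (snd (x i)).

Lemma is_lim_seq_psum (F : nat -> nat -> R) (f : nat -> R) m :
  (forall j, is_lim_seq (fun n => F n j) (f j)) ->
  is_lim_seq (fun n => psum (F n) m) (psum f m).
Proof.
  intros H; induction m as [|m IH]; simpl; [apply is_lim_seq_const|].
  apply is_lim_seq_plus'; [exact IH|exact (H m)].
Qed.

Lemma cvg_pointwise_matop W K M X x : band W K M -> cvg_pointwise X x ->
  cvg_pointwise (fun n => matop M (X n)) (matop M x).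
Proof.
  intros HM HX i. rewrite (matop_band W K M x i (i + W + 1) HM) by lia.
  split.
  - apply (is_lim_seq_ext (fun n => psum (fun j => fst (Cmult (M i j) (X n j))) (i + W + 1))).
    { intros n; now rewrite (matop_band W K M _ i (i + W + 1) HM) by lia. }
    apply is_lim_seq_psum; intros j; destruct (HX j); simpl.
    apply is_lim_seq_minus'; apply is_lim_seq_mult'; auto using is_lim_seq_const.
  - apply (is_lim_seq_ext (fun n => psum (fun j => snd (Cmult (M i j) (X n j))) (i + W + 1))).
    { intros n; now rewrite (matop_band W K M _ i (i + W + 1) HM) by lia. }
    apply is_lim_seq_psum; intros j; destruct (HX j); simpl.
    apply is_lim_seq_plus'; apply is_lim_seq_mult'; auto using is_lim_seq_const.
Qed.

Lemma cvg_pointwise_unique X x y : cvg_pointwise X x -> cvg_pointwise X y -> x = y.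
Proof.
  intros Hx Hy; apply functional_extensionality; intros i.
  destruct (Hx i) as [H1 H2], (Hy i) as [H3 H4].
  apply injective_projections.
  - apply is_lim_seq_unique in H1; apply is_lim_seq_unique in H3. congruence.
  - apply is_lim_seq_unique in H2; apply is_lim_seq_unique in H4. congruence.
Qed.

(** Fatou's argument: the bound passes to the limit in each finite partial sum. *)
Lemma cvg_pointwise_l2 X x B :
  cvg_pointwise X x -> (forall n, l2 (X n) /\ nsq (X n) <= B) -> l2 x.
Proof.
  intros HX HB. apply (l2_bounded x B). intros m.
  apply (is_lim_seq_le (fun n => psum (fun i => Cmod (X n i) ^ 2) m) (fun _ => B)
           (psum (fun i => Cmod (x i) ^ 2) m) B);
    [|apply is_lim_seq_psum|apply is_lim_seq_const].
  - intros n. destruct (HB n). eapply Rle_trans; [now apply psum_le_nsq|auto].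
  - intros j. destruct (HX j) as [H1 H2]. rewrite Cmod_sqr.
    apply (is_lim_seq_ext (fun n => fst (X n j) * fst (X n j) + snd (X n j) * snd (X n j))).
    { intros n; now rewrite Cmod_sqr. }
    apply is_lim_seq_plus'; apply is_lim_seq_mult'; auto.
Qed.

Fixpoint vsum (r : nat -> nat -> C) (n : nat) : nat -> C :=
  match n with O => vzero | S n => vadd (vsum r n) (r n) end.

Lemma vsum_fst r n i : fst (vsum r n i) = psum (fun k => fst (r k i)) n.
Proof. induction n as [|n IH]; simpl; auto. now rewrite IH. Qed.

Lemma vsum_snd r n i : snd (vsum r n i) = psum (fun k => snd (r k i)) n.
Proof. induction n as [|n IH]; simpl; auto. now rewrite IH. Qed.

Lemma psum_geom q n : 0 <= q < 1 -> psum (pow q) n <= / (1 - q).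
Proof.
  intros Hq.
  assert (E : psum (pow q) n * (1 - q) = 1 - q ^ n).
  { induction n as [|n IH]; simpl; [ring|]. rewrite Rmult_plus_distr_r, IH; ring. }
  apply Rmult_le_reg_r with (1 - q); [lra|]. rewrite E, Rinv_l by lra.
  generalize (pow_le q n (proj1 Hq)); lra.
Qed.

(* Only pointwise convergence of the series is obtained; that suffices because
   a row of a band matrix involves finitely many coordinates. *)
Lemma vsum_geometric r D q : 0 <= q < 1 ->
  (forall k, l2 (r k) /\ l2norm (r k) <= D * q ^ k) ->
  exists x, l2 x /\ cvg_pointwise (vsum r) x.
Proof.
  intros Hq Hr.
  assert (HD : 0 <= D).
  { destruct (Hr O) as [_ H]. generalize (l2norm_nonneg (r O)). simpl in H; lra. }
  assert (Hent : forall k i, Cmod (r k i) <= D * q ^ k).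
  { intros k i; destruct (Hr k) as [H1 H2]. apply Rle_trans with (2 := H2).
    apply Rsqr_incr_0_var; [|apply l2norm_nonneg]. rewrite !Rsqr_pow2, l2norm_sqr by auto.
    now apply Cmod_le_nsq. }
  assert (Hg : ex_series (fun k => D * q ^ k)).
  { apply (ex_series_scal (V := R_NormedModule)), ex_series_geom. rewrite Rabs_pos_eq; lra. }
  set (x := fun i => (Series (fun k => fst (r k i)), Series (fun k => snd (r k i))) : C).
  assert (Hc : cvg_pointwise (vsum r) x).
  { intros i; split.
    - apply (is_lim_seq_ext (psum (fun k => fst (r k i)))); [intros; now rewrite vsum_fst|].
      apply is_series_psum, Series_correct.
      apply (ex_series_le (V := R_CompleteNormedModule)) with (2 := Hg).
      intros k; apply Rle_trans with (2 := Hent k i), Rle_trans with (2 := Rmax_Cmod _), Rmax_l.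
    - apply (is_lim_seq_ext (psum (fun k => snd (r k i)))); [intros; now rewrite vsum_snd|].
      apply is_series_psum, Series_correct.
      apply (ex_series_le (V := R_CompleteNormedModule)) with (2 := Hg).
      intros k; apply Rle_trans with (2 := Hent k i), Rle_trans with (2 := Rmax_Cmod _), Rmax_r. }
  exists x; split; [|exact Hc].
  apply (cvg_pointwise_l2 _ _ ((D * / (1 - q)) ^ 2) Hc). intros n.
  assert (H : l2 (vsum r n) /\ l2norm (vsum r n) <= D * psum (pow q) n).
  { induction n as [|n [IH1 IH2]]; simpl.
    - split; [apply l2_vzero|]. unfold l2norm; fold (nsq vzero). rewrite nsq_vzero, sqrt_0; lra.
    - destruct (Hr n). split; [now apply l2_vadd|].
      eapply Rle_trans; [now apply l2norm_vadd|]. lra. }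
  destruct H as [H1 H2]; split; auto. rewrite <- l2norm_sqr by auto.
  apply pow_incr; split; [apply l2norm_nonneg|].
  apply Rle_trans with (1 := H2), Rmult_le_compat_l; auto. now apply psum_geom.
Qed.

(* [P = M M^*] is coercive, so [1 - t P] is a contraction for a suitable [t > 0] and
   [P] is inverted by the Neumann series [t * sum_k (1 - t P)^k]. *)
Lemma surjective_of_lower_bound_adj W K M d : band W K M -> 0 < d ->
  lower_bound (adjM M) d -> forall y, l2 y -> exists x, l2 x /\ matop M x = y.
Proof.
  intros HM Hd HL y Hy. assert (HMs := band_adjM _ _ _ HM).
  set (P := fun p => matop M (matop (adjM M) p)).
  (* [k] dominates the norms of [M] and of its adjoint; the summand [1 + d] ensures [d <= k ^ 2], so
     the contraction factor below is not negative. *)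
  set (k := opbound W K + 1 + d).
  assert (Hk0 : 0 <= opbound W K) by now apply opbound_nonneg with M.
  assert (Hk : forall A x, band W K A -> l2 x -> nsq (matop A x) <= k ^ 2 * nsq x).
  { intros A x HA Hx. eapply Rle_trans; [now apply (band_bounded W K)|].
    apply Rmult_le_compat_r; [now apply nsq_nonneg|]. apply pow_incr; unfold k; lra. }
  assert (Hdk : d <= k ^ 2) by (unfold k; nra).
  assert (HPl2 : forall p, l2 p -> l2 (P p)) by (intros; unfold P; eauto using l2_matop).
  (* This [t] minimises [1 - 2 * t * d + t ^ 2 * k ^ 4], the bound for the squared norm of [Q]; the
     minimum is [q2]. *)
  set (t := d / k ^ 4).
  assert (Hk4 : 0 < k ^ 4) by (apply pow_lt; unfold k; lra).
  assert (Ht : 0 < t) by (now apply Rdiv_lt_0_compat).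
  set (Q := fun p => vadd p (vscal (RtoC (- t)) (P p))).
  assert (HQl2 : forall p, l2 p -> l2 (Q p)) by (intros; unfold Q; auto using l2_vadd, l2_vscal).
  set (q2 := 1 - d ^ 2 / k ^ 4).
  assert (HQ : forall p, l2 p -> nsq (Q p) <= q2 * nsq p).
  { intros p Hp. unfold Q. rewrite nsq_vadd, nsq_vscal, ip_vscal_r, Cmod_R, pow2_abs by auto using l2_vscal.
    assert (E : ip p (P p) = nsq (matop (adjM M) p)).
    { unfold P. rewrite ip_sym, (ip_matop W K) by eauto using l2_matop. now rewrite nsq_ip. }
    rewrite E. assert (H1 := HL p Hp).
    assert (H2 : nsq (P p) <= k ^ 4 * nsq p).
    { unfold P. eapply Rle_trans; [apply Hk; eauto using l2_matop|].
      replace (k ^ 4) with (k ^ 2 * k ^ 2) by ring. rewrite Rmult_assoc.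
      apply Rmult_le_compat_l; [apply pow2_ge_0|auto]. }
    apply Rle_trans with (nsq p + 2 * (- t * (d * nsq p)) + t ^ 2 * (k ^ 4 * nsq p)).
    - replace ((- t) ^ 2) with (t ^ 2) by ring.
      apply Rplus_le_compat; [|apply Rmult_le_compat_l; [apply pow2_ge_0|auto]].
      assert (t * (d * nsq p) <= t * nsq (matop (adjM M) p)) by (apply Rmult_le_compat_l; lra). lra.
    - right; unfold q2, t; field; unfold k; lra. }
  assert (Hq2 : 0 <= q2 < 1).
  { assert (d ^ 2 <= k ^ 4) by (replace (k ^ 4) with ((k ^ 2) ^ 2) by ring; apply pow_incr; lra).
    assert (d ^ 2 / k ^ 4 <= 1) by (apply Rle_div_l; lra).
    assert (0 < d ^ 2 / k ^ 4) by (apply Rdiv_lt_0_compat; auto; apply pow_lt; auto).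
    unfold q2; lra. }
  set (q := sqrt q2).
  assert (Hq : 0 <= q < 1).
  { split; [apply sqrt_pos|]. unfold q; rewrite <- sqrt_1; apply sqrt_lt_1_alt; lra. }
  assert (Hqq : q ^ 2 = q2) by (apply pow2_sqrt; lra).
  set (res := fun n => Nat.iter n Q y).
  assert (Hres : forall n, l2 (res n) /\ l2norm (res n) <= l2norm y * q ^ n).
  { induction n as [|n [IH1 IH2]]; [simpl; split; auto; lra|].
    change (res (S n)) with (Q (res n)). split; auto.
    apply Rle_trans with (q * l2norm (res n)).
    - apply nsq_le_l2norm; auto; [apply Hq|]. rewrite Hqq; auto.
    - simpl. replace (l2norm y * (q * q ^ n)) with (q * (l2norm y * q ^ n)) by ring.
      apply Rmult_le_compat_l; [apply Hq|auto]. }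
  destruct (vsum_geometric (fun n => vscal (RtoC t) (res n)) (t * l2norm y) q Hq) as [x [Hx Hc]].
  { intros n; destruct (Hres n); split; [now apply l2_vscal|].
    rewrite l2norm_vscal, Cmod_R, Rabs_pos_eq, Rmult_assoc by (auto; lra).
    apply Rmult_le_compat_l; lra. }
  exists (matop (adjM M) x). split; [eauto using l2_matop|].
  (* The images under [P] of the partial sums have two pointwise limits: the image of [x], since
     band rows are finite, and [y], since [res n] is the residual after [n] terms and tends to 0. *)
  apply (cvg_pointwise_unique (fun n => P (vsum (fun n => vscal (RtoC t) (res n)) n))).
  { apply (cvg_pointwise_matop W K M _ _ HM), (cvg_pointwise_matop W K _ _ _ HMs), Hc. }
  assert (HP : forall n, P (vsum (fun n => vscal (RtoC t) (res n)) n) = vadd y (vscal (RtoC (-1)) (res n))).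
  { induction n as [|n IH].
    - simpl. unfold P.
      replace vzero with (vscal (RtoC 0) vzero)
        by (apply functional_extensionality; intros; apply Cmult_0_l).
      rewrite !(matop_vscal W K) by auto.
      apply functional_extensionality; intros i; unfold vadd, vscal, res; simpl.
      apply injective_projections; simpl; ring.
    - simpl vsum. unfold P in *. rewrite !(matop_vadd W K), !(matop_vscal W K), IH by auto.
      change (res (S n)) with (Q (res n)). unfold Q, P.
      apply functional_extensionality; intros i; unfold vadd, vscal.
      apply injective_projections; simpl; ring. }
  assert (H0 : forall i (f : C -> R), (forall z, Rabs (f z) <= Cmod z) ->
     is_lim_seq (fun n => f (res n i)) 0).
  { intros i f Hf. apply is_lim_seq_abs_0.
    apply (is_lim_seq_le_le (fun _ => 0) _ (fun n => l2norm y * q ^ n)).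
    - intros n; split; [apply Rabs_pos|]. apply Rle_trans with (1 := Hf _).
      destruct (Hres n) as [H1 H2]. apply Rle_trans with (2 := H2).
      apply Rsqr_incr_0_var; [|apply l2norm_nonneg]. rewrite !Rsqr_pow2, l2norm_sqr by auto.
      now apply Cmod_le_nsq.
    - apply is_lim_seq_const.
    - replace 0 with (l2norm y * 0) by ring. apply is_lim_seq_mult'; [apply is_lim_seq_const|].
      apply is_lim_seq_geom. rewrite Rabs_pos_eq; lra. }
  intros i; split.
  - apply (is_lim_seq_ext (fun n => fst (y i) - fst (res n i))).
    { intros n; rewrite HP; unfold vadd, vscal; simpl; ring. }
    replace (Finite (fst (y i))) with (Finite (fst (y i) - 0)) by (f_equal; ring).
    apply is_lim_seq_minus'; [apply is_lim_seq_const|]. apply (H0 i fst).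
    intros z; apply Rle_trans with (2 := Rmax_Cmod _), Rmax_l.
  - apply (is_lim_seq_ext (fun n => snd (y i) - snd (res n i))).
    { intros n; rewrite HP; unfold vadd, vscal; simpl; ring. }
    replace (Finite (snd (y i))) with (Finite (snd (y i) - 0)) by (f_equal; ring).
    apply is_lim_seq_minus'; [apply is_lim_seq_const|]. apply (H0 i snd).
    intros z; apply Rle_trans with (2 := Rmax_Cmod _), Rmax_r.
Qed.

(** The bound for [M] gives injectivity and the size of the inverse, the one for the adjoint gives
    surjectivity. On the half axis neither follows from the other, as the unilateral shift shows. *)
Definition bounded_below (M : nat -> nat -> C) (d : R) : Prop :=
  lower_bound M d /\ lower_bound (adjM M) d.

Lemma lower_bound_mono M d d' : d' <= d -> lower_bound M d -> lower_bound M d'.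
Proof.
  intros H HL x Hx. apply Rle_trans with (2 := HL x Hx).
  apply Rmult_le_compat_r; [now apply nsq_nonneg|auto].
Qed.

Lemma bounded_below_mono M d d' : d' <= d -> bounded_below M d -> bounded_below M d'.
Proof. intros H [H1 H2]; split; eauto using lower_bound_mono. Qed.

Lemma is_inverse_of_bounded_below W K M e : band W K M -> 0 < e ->
  bounded_below M (e ^ 2) -> invertible (matop M).
Proof.
  intros HM He [HL HLs].
  assert (He2 : 0 < e ^ 2) by (apply pow_lt; auto).
  assert (Hsurj := surjective_of_lower_bound_adj W K M _ HM He2 HLs).
  (* Surjectivity is a bare existence statement, so the preimage is chosen. The value outside [l2]
     is arbitrary, and [is_inverse] constrains [B] only on [l2]. *)
  set (B := fun y => epsilon (inhabits vzero) (fun x => l2 x /\ matop M x = y)).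
  assert (HB : forall y, l2 y -> l2 (B y) /\ matop M (B y) = y).
  { intros y Hy. apply (epsilon_spec (inhabits vzero) (fun x => l2 x /\ matop M x = y)); auto. }
  exists B; repeat split.
  - intros; now apply HB.
  - exists (/ e). intros y Hy. destruct (HB y Hy) as [H1 H2].
    apply Rmult_le_reg_l with e; auto. rewrite <- Rmult_assoc, Rinv_r, Rmult_1_l by lra.
    rewrite <- (sqrt_pow2 e) at 1 by lra. unfold l2norm; fold (nsq (B y)) (nsq y).
    rewrite <- sqrt_mult; [|lra|now apply nsq_nonneg].
    apply sqrt_le_1_alt. specialize (HL (B y) H1). rewrite H2 in HL. exact HL.
  - intros; now apply HB.
  - intros x Hx. destruct (HB (matop M x)) as [H1 H2]; [now apply l2_matop with W K|].
    (* The difference of [B (matop M x)] and [x] lies in the kernel of [M], which the lower bound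
       makes trivial. *)
    assert (Hd : l2 (vadd (B (matop M x)) (vscal (RtoC (-1)) x))) by auto using l2_vadd, l2_vscal.
    assert (E : vadd (B (matop M x)) (vscal (RtoC (-1)) x) = vzero).
    { apply nsq_zero_inv; auto. specialize (HL _ Hd).
      rewrite (matop_vadd W K), (matop_vscal W K), H2 in HL by auto.
      replace (vadd (matop M x) (vscal (RtoC (-1)) (matop M x))) with vzero in HL.
      - rewrite nsq_vzero in HL. apply Rmult_le_reg_l with (e ^ 2); lra.
      - apply functional_extensionality; intros i; unfold vadd, vscal, vzero.
        apply injective_projections; simpl; ring. }
    apply functional_extensionality; intros i.
    assert (Ei := equal_f E i). unfold vadd, vscal, vzero in Ei.
    apply injective_projections.
    + apply (f_equal fst) in Ei; simpl in Ei; lra.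
    + apply (f_equal snd) in Ei; simpl in Ei; lra.
Qed.

(** For the adjoint, no inverse of it is constructed: |x|^2 = (M B x, x) = (B x, M^* x) is at most
    |B x| |M^* x|, and |B x| is at most |x| / e. *)
Lemma bounded_below_of_inverse W K M B e : band W K M -> 0 < e -> is_inverse (matop M) B ->
  (forall y, l2 y -> e * l2norm (B y) <= l2norm y) -> bounded_below M (e ^ 2).
Proof.
  intros HM He (H1 & _ & H3 & H4) HB.
  assert (HB2 : forall y, l2 y -> e ^ 2 * nsq (B y) <= nsq y).
  { intros y Hy. rewrite <- !l2norm_sqr, <- Rpow_mult_distr by auto.
    apply pow_incr; split; auto. apply Rmult_le_pos; [lra|apply l2norm_nonneg]. }
  split; intros x Hx.
  - specialize (HB2 (matop M x)). rewrite H4 in HB2 by auto. eauto using l2_matop.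
  - assert (HMs := l2_matop _ _ _ x (band_adjM _ _ _ HM) Hx).
    assert (E : nsq x = ip (B x) (matop (adjM M) x)).
    { rewrite <- (ip_matop W K) by auto. now rewrite H3, nsq_ip. }
    assert (H5 := ip_le_norms _ _ (H1 x Hx) HMs). rewrite <- E in H5.
    specialize (HB x Hx).
    rewrite <- l2norm_sqr in H5 by auto. rewrite <- !l2norm_sqr by auto.
    generalize (l2norm_nonneg x); set (p := l2norm x) in *; intros Hpe.
    generalize (l2norm_nonneg (B x)) (l2norm_nonneg (matop (adjM M) x)).
    set (a := l2norm (B x)) in *. set (b := l2norm (matop (adjM M) x)) in *. intros Ha Hb.
    assert (Hpb : e * p <= b).
    { destruct (Req_dec p 0) as [->|Hp0]; [lra|].
      apply Rmult_le_reg_r with p; [lra|]. nra. }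
    rewrite <- Rpow_mult_distr. apply pow_incr; split; auto. apply Rmult_le_pos; lra.
Qed.

(** [is_inverse] does not ask for linearity of [B]; homogeneity is inherited from [M] by uniqueness
    of preimages. *)
Lemma is_inverse_vscal W K M B c y : band W K M -> is_inverse (matop M) B -> l2 y ->
  B (vscal c y) = vscal c (B y).
Proof.
  intros HM (H1 & _ & H3 & H4) Hy.
  rewrite <- (H4 (vscal c (B y))) by auto using l2_vscal.
  now rewrite (matop_vscal W K), H3.
Qed.

Lemma matop_vzero W K M : band W K M -> matop M vzero = vzero.
Proof.
  intros HM. replace vzero with (vscal (RtoC 0) vzero) at 1
    by (apply functional_extensionality; intros; apply Cmult_0_l).
  rewrite (matop_vscal W K) by auto.
  apply functional_extensionality; intros; apply Cmult_0_l.
Qed.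

(** The bridge between the extended-real resolvent norm and inequalities for vectors. Non-invertible
    matrices fit in because their value [p_infty] exceeds [/ e] and because two-sided lower bounds
    force invertibility. *)
Lemma resnorm_le_iff W K M e : band W K M -> 0 < e ->
  Rbar_le (resnorm (matop M)) (Finite (/ e)) <-> bounded_below M (e ^ 2).
Proof.
  intros HM He. unfold resnorm.
  destruct (excluded_middle_informative (invertible (matop M))) as [[B HB]|Hn].
  2:{ split; [simpl; tauto|]. intros H; exfalso; apply Hn.
      now apply (is_inverse_of_bounded_below W K M e). }
  set (E := fun r => exists B, _).
  destruct (Lub_Rbar_correct E) as [Hub Hlub].
  split; intros H.
  - apply (bounded_below_of_inverse W K M B e HM He HB). intros y Hy.
    (* The supremum only sees the unit ball, so [y] is normalised; for a vector of norm 0 the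
       boundedness of [B] gives the claim. *)
    destruct (Req_dec (l2norm y) 0) as [E0|E0].
    + destruct HB as (_ & [k Hk] & _). specialize (Hk y Hy). rewrite E0, Rmult_0_r in *.
      generalize (l2norm_nonneg (B y)); nra.
    + assert (Hp : 0 < l2norm y) by (generalize (l2norm_nonneg y); lra).
      assert (Hi : 0 < / l2norm y) by now apply Rinv_0_lt_compat.
      assert (HE : E (l2norm (B (vscal (RtoC (/ l2norm y)) y)))).
      { exists B; split; auto. eexists; split; [|split; [|reflexivity]]; [now apply l2_vscal|].
        rewrite l2norm_vscal, Cmod_R, Rabs_pos_eq by (auto; lra). right; now apply Rinv_l. }
      assert (H1 := Rbar_le_trans _ _ _ (Hub _ HE) H). simpl in H1.
      assert (HBy : l2 (B y)) by now apply (proj1 HB).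
      rewrite (is_inverse_vscal W K M), l2norm_vscal, Cmod_R, Rabs_pos_eq in H1 by (auto; lra).
      apply Rmult_le_reg_l with (/ l2norm y * / e).
      { apply Rmult_lt_0_compat; auto. now apply Rinv_0_lt_compat. }
      replace (/ l2norm y * / e * (e * l2norm (B y))) with (/ l2norm y * l2norm (B y)) by (field; lra).
      replace (/ l2norm y * / e * l2norm y) with (/ e) by (field; lra). exact H1.
  - apply Hlub. intros r (B' & HB' & y & Hy & Hy1 & ->). simpl.
    destruct HB' as (H1 & _ & H3 & _), H as [HL _].
    specialize (HL (B' y) (H1 y Hy)). rewrite H3 in HL by auto.
    apply Rle_trans with (/ e * l2norm y).
    + apply nsq_le_l2norm; auto; [now apply Rlt_le, Rinv_0_lt_compat|].
      apply Rmult_le_reg_l with (e ^ 2); [now apply pow_lt|].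
      replace (e ^ 2 * ((/ e) ^ 2 * nsq y)) with (nsq y) by (field; lra). exact HL.
    + rewrite <- (Rmult_1_r (/ e)) at 2.
      apply Rmult_le_compat_l; auto. now apply Rlt_le, Rinv_0_lt_compat.
Qed.

Definition delta0 : nat -> C := restrict 0 1 (fun _ => RtoC 1).

Lemma l2_delta0 : l2 delta0.
Proof. exact (l2_supported _ _ _ (supported_restrict 0 1 _)). Qed.

Lemma nsq_delta0 : nsq delta0 = 1.
Proof.
  rewrite (nsq_supported 0 1) by apply supported_restrict. simpl.
  unfold delta0, restrict; simpl. rewrite Cmod_1; ring.
Qed.

(** Excludes [m_infty] as a limit, and leaves room for positive levels below a finite limit, whose
    reciprocals are then lower bounds. A zero value would force [B delta0 = 0], although [M] maps
    [B delta0] to [delta0]. *)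
Lemma resnorm_pos W K M : band W K M -> Rbar_lt (Finite 0) (resnorm (matop M)).
Proof.
  intros HM. unfold resnorm.
  destruct (excluded_middle_informative (invertible (matop M))) as [[B HB]|Hn]; [|simpl; auto].
  set (E := fun r => exists B, _).
  destruct (Lub_Rbar_correct E) as [Hub _].
  assert (HBe : l2 (B delta0)) by (apply (proj1 HB), l2_delta0).
  apply Rbar_lt_le_trans with (Finite (l2norm (B delta0))).
  - simpl. apply sqrt_lt_R0. fold (nsq (B delta0)).
    apply Rnot_le_lt; intros H. apply nsq_zero_inv in H; auto.
    destruct HB as (_ & _ & H3 & _). specialize (H3 delta0 l2_delta0).
    rewrite H, (matop_vzero W K) in H3 by auto.
    generalize nsq_delta0; rewrite <- H3, nsq_vzero; lra.
  - apply Hub. exists B; split; auto. exists delta0; split; [apply l2_delta0|split; auto].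
    unfold l2norm; fold (nsq delta0). rewrite nsq_delta0, sqrt_1; lra.
Qed.

(** * Localisation of lower bounds *)

Definition lower_bound_on (M : nat -> nat -> C) (N : nat) (d : R) : Prop :=
  forall s x, supported s (s + N) x -> d * nsq x <= nsq (matop M x).

Lemma matop_supported W K M n x : band W K M -> supported 0 n x ->
  supported 0 (n + W) (matop M x).
Proof.
  intros HM Hx i Hi. rewrite (matop_csum M x i n).
  - apply csum_zero; intros j Hj. rewrite (band_zero W K M) by (auto; lia). apply Cmult_0_l.
  - intros j Hj; rewrite Hx by lia; apply Cmult_0_r.
Qed.

Lemma restrict_indic a b x i : restrict a b x i = Cmult (RtoC (indic a b i)) (x i).
Proof.
  destruct (restrict_cases a b x i) as [[? ->]|[? ->]],
    (indic_cases a b i) as [[? ->]|[? ->]]; try tauto; ring.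
Qed.

(** Windows are indexed by their right end [k], so those cut off at 0 are included and every
    coordinate, even near the boundary, lies in exactly [N] of them. *)
Lemma indic_window N k i : indic (k - N) k i = indic (i + 1) (i + N + 1) k.
Proof.
  destruct (indic_cases (k - N) k i) as [[? ->]|[? ->]],
    (indic_cases (i + 1) (i + N + 1) k) as [[? ->]|[? ->]]; auto; lia.
Qed.

(** A window separates [i] from [j] only if one of its two ends falls between them, which leaves at
    most |i - j| positions for each end. *)
Lemma window_diff_sum N i j Q :
  psum (fun k => (indic (k - N) k j - indic (k - N) k i) ^ 2) Q
  <= 2 * INR (Nat.max i j - Nat.min i j).
Proof.
  set (a := Nat.min i j). set (b := Nat.max i j).
  apply Rle_trans with
    (psum (fun k => indic (a + 1) (b + 1) k + indic (a + N + 1) (b + N + 1) k) Q).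
  - apply psum_le; intros k _. rewrite !indic_window.
    destruct (indic_cases (j + 1) (j + N + 1) k) as [[? ->]|[? ->]],
      (indic_cases (i + 1) (i + N + 1) k) as [[? ->]|[? ->]],
      (indic_cases (a + 1) (b + 1) k) as [[? ->]|[? ->]],
      (indic_cases (a + N + 1) (b + N + 1) k) as [[? ->]|[? ->]]; try lra; unfold a, b in *; lia.
  - rewrite psum_plus.
    assert (H1 := psum_indic_le (a + 1) (b + 1) Q).
    assert (H2 := psum_indic_le (a + N + 1) (b + N + 1) Q).
    replace (b + 1 - (a + 1))%nat with (b - a)%nat in H1 by lia.
    replace (b + N + 1 - (a + N + 1))%nat with (b - a)%nat in H2 by lia. lra.
Qed.

Lemma Cmod_sqr_plus_le z w t : 0 < t ->
  Cmod (Cplus z w) ^ 2 <= (1 + t) * Cmod z ^ 2 + (1 + / t) * Cmod w ^ 2.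
Proof.
  intros Ht. rewrite !Cmod_sqr. destruct z as [a b], w as [c d]; unfold cdot; simpl.
  assert (H : forall p q, (p + q) * (p + q) <= (1 + t) * (p * p) + (1 + / t) * (q * q)).
  { intros p q. assert (0 <= / t * (t * p - q) ^ 2).
    { apply Rmult_le_pos; [now apply Rlt_le, Rinv_0_lt_compat|apply pow2_ge_0]. }
    replace (/ t * (t * p - q) ^ 2) with (t * (p * p) - 2 * p * q + / t * (q * q)) in H by (field; lra).
    lra. }
  generalize (H a c) (H b d); lra.
Qed.

(** [K ^ 2 * INR (2 * W + 1)] comes from Cauchy-Schwarz in a row, [2 * INR W] from the windows
    separating two indices at distance at most [W], and the last factor from the number of rows
    meeting a column. *)
Definition commutator_bound (W : nat) (K : R) : R :=
  K ^ 2 * INR (2 * W + 1) * (2 * INR W * INR (2 * W + 1)).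

(* Average over all sliding windows of length [N]: each coordinate lies in exactly [N] of
   them, whereas the commutator of [M] with a window only sees the few windows having
   an end within distance [W]. *)
Lemma window_average W K M N d t x n : band W K M -> 0 < t ->
  lower_bound_on M N d -> supported 0 n x ->
  INR N * d * nsq x
  <= (1 + t) * INR N * nsq (matop M x) + (1 + / t) * commutator_bound W K * nsq x.
Proof.
  intros HM Ht HL Hx.
  (* [matop M x] vanishes from row [J] on, and all [N] windows containing a coordinate below [J]
     have their right end below [Q]. *)
  set (J := (n + W)%nat). set (Q := (J + N + 1)%nat).
  set (phi := fun k i => indic (k - N) k i).
  set (g := fun i => Cmod (matop M x i) ^ 2). set (h := fun j => Cmod (x j) ^ 2).
  set (D := INR (2 * W + 1)).
  assert (Hg : nsq (matop M x) = psum g J) by (apply (nsq_supported 0), (matop_supported W K); auto).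
  assert (Hh : nsq x = psum h n) by now apply (nsq_supported 0).
  assert (Hh0 : forall j, 0 <= h j) by (intros; apply pow2_ge_0).
  assert (Hphi : forall i, (i < J)%nat -> psum (fun k => phi k i) Q = INR N).
  { intros i Hi. rewrite (psum_ext _ (indic (i + 1) (i + N + 1))) by (intros; apply indic_window).
    rewrite psum_indic. f_equal. unfold Q; lia. }
  assert (Hwin : forall k, supported 0 n (restrict (k - N) k x)).
  { intros k i Hi. rewrite restrict_indic, Hx by auto. apply Cmult_0_r. }
  assert (Hnsq : forall k, nsq (restrict (k - N) k x) = psum (fun i => phi k i * h i) n).
  { intros k. rewrite (nsq_supported 0 n) by auto. apply psum_ext; intros i _.
    rewrite restrict_indic, Cmod_mult, Cmod_R, Rabs_pos_eq by apply indic_nonneg.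
    unfold phi, h. destruct (indic_cases (k - N) k i) as [[_ ->]|[_ ->]]; ring. }
  set (c := fun k i j => phi k j - phi k i).
  assert (Hcomm : forall k i, (i < J)%nat ->
    Cmod (matop M (restrict (k - N) k x) i) ^ 2
    <= (1 + t) * (phi k i * g i)
       + (1 + / t) * (K ^ 2 * D * psum (fun j => indic (i - W) (i + W + 1) j * (c k i j ^ 2 * h j)) n)).
  { intros k i Hi.
    (* Row [i] of [M] applied to the windowed vector is the windowed row of [matop M x] plus the
       commutator, whose coefficients [c k i j] vanish unless the window separates [i] from [j]. *)
    replace (matop M (restrict (k - N) k x) i) with
      (Cplus (Cmult (RtoC (phi k i)) (matop M x i))
             (csum (fun j => Cmult (M i j) (Cmult (RtoC (c k i j)) (x j))) n)).
    2:{ rewrite (matop_csum M x i n), (matop_csum M (restrict _ _ x) i n), <- csum_scal, <- csum_plus.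
        - apply csum_ext; intros j _. rewrite restrict_indic. unfold c, phi. rewrite RtoC_minus. ring.
        - intros j Hj; rewrite (Hwin k) by lia; apply Cmult_0_r.
        - intros j Hj; rewrite Hx by lia; apply Cmult_0_r. }
    eapply Rle_trans; [apply Cmod_sqr_plus_le, Ht|].
    apply Rplus_le_compat.
    - right. f_equal. rewrite Cmod_mult, Cmod_R, Rabs_pos_eq by apply indic_nonneg.
      unfold phi, g. destruct (indic_cases (k - N) k i) as [[_ ->]|[_ ->]]; ring.
    - apply Rmult_le_compat_l; [generalize (Rinv_0_lt_compat t Ht); lra|].
      eapply Rle_trans; [apply (band_row_bound W K M _ i n HM)|]. right. unfold D.
      f_equal. apply psum_ext; intros j _. rewrite Cmod_mult, Rpow_mult_distr, Cmod_R, pow2_abs.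
      unfold h; ring. }
  assert (Hsum : psum (fun k => d * nsq (restrict (k - N) k x)) Q
    <= psum (fun k => psum (fun i => Cmod (matop M (restrict (k - N) k x) i) ^ 2) J) Q).
  { apply psum_le; intros k _.
    rewrite <- (nsq_supported 0 J) by (apply (matop_supported W K); auto).
    apply (HL (k - N)%nat). intros i Hi.
    destruct (restrict_cases (k - N) k x i) as [[? _]|[_ ->]]; [lia|auto]. }
  rewrite psum_scal in Hsum.
  rewrite (psum_ext (fun k => nsq _) (fun k => psum (fun i => phi k i * h i) n)) in Hsum by auto.
  rewrite psum_exchange in Hsum.
  rewrite (psum_ext (fun i => psum (fun k => phi k i * h i) Q) (fun i => INR N * h i)) in Hsum.
  2:{ intros i Hi. rewrite (psum_ext _ (fun k => h i * phi k i)) by (intros; ring).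
      rewrite psum_scal, Hphi by (unfold J; lia). ring. }
  rewrite psum_scal, <- Hh in Hsum.
  replace (INR N * d * nsq x) with (d * (INR N * nsq x)) by ring.
  apply Rle_trans with (1 := Hsum).
  eapply Rle_trans; [apply psum_le; intros k _; apply psum_le; intros i Hi; apply Hcomm, Hi|].
  rewrite psum_exchange.
  apply Rle_trans with (psum (fun i => (1 + t) * INR N * g i
    + (1 + / t) * (K ^ 2 * D * (2 * INR W))
       * psum (fun j => indic (i - W) (i + W + 1) j * h j) n) J).
  - apply psum_le; intros i Hi.
    rewrite psum_plus, psum_scal, psum_scal, psum_scal.
    apply Rplus_le_compat.
    + right. rewrite (psum_ext _ (fun k => g i * phi k i)) by (intros; ring).
      rewrite psum_scal, Hphi by auto. ring.
    + rewrite !Rmult_assoc. apply Rmult_le_compat_l; [generalize (Rinv_0_lt_compat t Ht); lra|].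
      apply Rmult_le_compat_l; [apply pow2_ge_0|]. apply Rmult_le_compat_l; [apply pos_INR|].
      rewrite psum_exchange, <- !psum_scal. apply psum_le; intros j _.
      rewrite (psum_ext _ (fun k => (indic (i - W) (i + W + 1) j * h j) * c k i j ^ 2)) by (intros; ring).
      rewrite psum_scal.
      destruct (indic_cases (i - W) (i + W + 1) j) as [[Hj ->]|[_ ->]]; [|right; ring].
      rewrite !Rmult_1_l, Rmult_comm, <- Rmult_assoc. apply Rmult_le_compat_r; auto.
      eapply Rle_trans; [apply window_diff_sum|].
      apply Rmult_le_compat_l; [lra|]. apply le_INR; lia.
  - rewrite psum_plus, !psum_scal, <- Hg. apply Rplus_le_compat_l.
    unfold commutator_bound; fold D.
    rewrite !Rmult_assoc. apply Rmult_le_compat_l; [generalize (Rinv_0_lt_compat t Ht); lra|].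
    apply Rmult_le_compat_l; [apply pow2_ge_0|]. apply Rmult_le_compat_l; [apply pos_INR|].
    apply Rmult_le_compat_l; [lra|]. apply Rmult_le_compat_l; [apply pos_INR|].
    rewrite Hh. now apply psum_band_sum.
Qed.

(** Finitely supported vectors are dense and [M] is continuous. The estimate is done for norms with
    [e = sqrt d], where replacing [x] by its truncation costs at most [(k + e) * l2norm t]. *)
Lemma lower_bound_of_finite W K M d : band W K M ->
  (forall n x, supported 0 n x -> d * nsq x <= nsq (matop M x)) -> lower_bound M d.
Proof.
  intros HM H x Hx.
  destruct (Rlt_le_dec d 0) as [Hd|Hd].
  { generalize (nsq_nonneg x Hx) (nsq_nonneg _ (l2_matop W K M x HM Hx)). nra. }
  set (e := sqrt d). assert (He : 0 <= e) by apply sqrt_pos.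
  assert (Ee : e ^ 2 = d) by now apply pow2_sqrt.
  set (k := opbound W K). assert (Hk : 0 <= k) by now apply opbound_nonneg with M.
  assert (HMx := l2_matop W K M x HM Hx).
  cut (e * l2norm x <= l2norm (matop M x)).
  { intros Hn. rewrite <- Ee, <- !l2norm_sqr, <- Rpow_mult_distr by auto.
    apply pow_incr; split; auto. apply Rmult_le_pos; auto using l2norm_nonneg. }
  apply Rle_of_lt_all; intros eta Heta.
  assert (Hb : 0 < k + e + 1) by lra.
  destruct (tail_small x ((eta / (k + e + 1)) ^ 2) Hx) as [n Hn].
  { apply pow_lt, Rdiv_lt_0_compat; auto. }
  set (t := vadd x _) in Hn. set (r := restrict 0 n x) in *.
  assert (Hrs : supported 0 n r) by apply supported_restrict.
  assert (Hr : l2 r) by now apply l2_supported with 0%nat n.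
  assert (Ht : l2 t) by (apply l2_vadd; auto using l2_vscal).
  assert (Hnt : l2norm t <= eta / (k + e + 1)).
  { rewrite <- (sqrt_pow2 (eta / (k + e + 1))) by (apply Rlt_le, Rdiv_lt_0_compat; auto).
    apply sqrt_le_1_alt; fold (nsq t); lra. }
  assert (Hkt : (k + e) * l2norm t <= eta).
  { apply Rle_trans with ((k + e + 1) * (eta / (k + e + 1))); [|right; field; lra].
    apply Rmult_le_compat; auto using l2norm_nonneg; lra. }
  assert (Ex : x = vadd t r).
  { apply functional_extensionality; intros i; unfold t, vadd, vscal.
    apply injective_projections; simpl; ring. }
  assert (Er : r = vadd x (vscal (RtoC (-1)) t)).
  { apply functional_extensionality; intros i; unfold t, vadd, vscal.
    apply injective_projections; simpl; ring. }
  assert (H1 : l2norm x <= l2norm t + l2norm r) by (rewrite Ex at 1; now apply l2norm_vadd).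
  assert (H2 : l2norm (matop M r) <= l2norm (matop M x) + k * l2norm t).
  { rewrite Er, (matop_vadd W K), (matop_vscal W K) by auto.
    assert (HMt := l2_matop W K M t HM Ht).
    eapply Rle_trans; [apply l2norm_vadd; auto using l2_vscal|].
    rewrite l2norm_vscal, Cmod_R, Rabs_left by (auto; lra).
    generalize (l2norm_matop W K M t HM Ht); fold k; lra. }
  assert (H3 : e * l2norm r <= l2norm (matop M r)).
  { assert (HMr := l2_matop W K M r HM Hr). specialize (H n r Hrs).
    rewrite <- Ee, <- !l2norm_sqr, <- Rpow_mult_distr in H by auto.
    apply Rsqr_incr_0_var; [now rewrite !Rsqr_pow2|apply l2norm_nonneg]. }
  assert (e * l2norm x <= e * (l2norm t + l2norm r)) by now apply Rmult_le_compat_l.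
  lra.
Qed.

(** The window length is chosen before the matrix and depends only on its band class; hence one [N]
    serves all [m], all [lam] in a disc, and the adjoints. *)
Lemma lower_bound_localise W K d delta : 0 <= d -> 0 < delta ->
  exists N, forall M, band W K M -> lower_bound_on M N d -> lower_bound M (d - delta).
Proof.
  intros Hd Hdelta.
  (* The loss [delta] is shared equally: [t] makes the factor [1 + t] cost at most [delta / 2], and
     [N] makes the averaged commutator cost at most [delta / 2]. *)
  set (t := delta / (2 * (d + 1))).
  assert (Ht : 0 < t) by (apply Rdiv_lt_0_compat; lra).
  assert (Htd : t * d <= delta / 2).
  { unfold t. apply Rle_trans with (delta / (2 * (d + 1)) * (d + 1)).
    - apply Rmult_le_compat_l; [now apply Rlt_le|lra].
    - right; field; lra. }
  set (c := (1 + / t) * commutator_bound W K).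
  assert (Hc0 : 0 <= c).
  { assert (0 < / t) by now apply Rinv_0_lt_compat.
    unfold c, commutator_bound.
    generalize (K ^ 2) (INR (2 * W + 1)) (INR W) (pow2_ge_0 K) (pos_INR (2 * W + 1)) (pos_INR W); intros.
    repeat apply Rmult_le_pos; lra. }
  destruct (nfloor_ex (c / (delta / 2))) as [N0 [_ HN0]].
  { apply Rmult_le_pos; auto. apply Rlt_le, Rinv_0_lt_compat; lra. }
  exists (S N0). intros M HM HL. apply (lower_bound_of_finite W K M _ HM). intros n x Hx.
  assert (Hl2 : l2 x) by now apply l2_supported with 0%nat n.
  assert (Hc := window_average W K M (S N0) d t x n HM Ht HL Hx). fold c in Hc.
  rewrite <- S_INR in HN0.
  set (v := INR (S N0)) in *.
  assert (Hv : 0 < v) by apply lt_0_INR, Nat.lt_0_succ.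
  assert (Hcv : c <= v * (delta / 2)).
  { apply Rlt_le. apply Rmult_lt_reg_r with (/ (delta / 2)); [apply Rinv_0_lt_compat; lra|].
    replace (v * (delta / 2) * / (delta / 2)) with v by (field; lra). exact HN0. }
  assert (Hx0 := nsq_nonneg x Hl2).
  assert (Hm0 := nsq_nonneg _ (l2_matop W K M x HM Hl2)).
  destruct (Rlt_le_dec (d - delta) 0) as [Hneg|Hpos]; [nra|].
  apply Rmult_le_reg_l with (v * (1 + t)); [apply Rmult_lt_0_compat; lra|].
  assert (c * nsq x <= v * (delta / 2) * nsq x) by now apply Rmult_le_compat_r.
  assert (v * nsq x * ((1 + t) * (d - delta)) <= v * nsq x * (d - delta / 2)).
  { apply Rmult_le_compat_l; [apply Rmult_le_pos; lra|]. nra. }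
  lra.
Qed.

(** * Transfer between matrices with the same local patterns *)

(** Every diagonal block of size [L] of [M] reappears in [M']. A block at the corner must reappear
    at the corner: elsewhere, a vector near its left end would also produce output in rows to its
    left. *)
Definition matching (M M' : nat -> nat -> C) (L : nat) : Prop :=
  forall s, exists s', (s = O -> s' = O) /\
    forall i j, (i < L)%nat -> (j < L)%nat -> M (s + i)%nat (s + j)%nat = M' (s' + i)%nat (s' + j)%nat.

Definition vshift (s : nat) (z : nat -> C) : nat -> C :=
  fun n => if Nat.leb s n then z (n - s)%nat else RtoC 0.

Lemma vshift_add s z i : vshift s z (s + i)%nat = z i.
Proof.
  unfold vshift. destruct (Nat.leb_spec s (s + i)); [f_equal; lia|lia].
Qed.

Lemma vshift_lt s z n : (n < s)%nat -> vshift s z n = RtoC 0.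
Proof. intros H; unfold vshift. destruct (Nat.leb_spec s n); [lia|auto]. Qed.

Lemma nsq_vshift s z : nsq (vshift s z) = nsq z.
Proof.
  unfold nsq. rewrite (Series_incr_n_aux _ s).
  - apply Series_ext; intros; now rewrite vshift_add.
  - intros k Hk; rewrite vshift_lt by auto. rewrite Cmod_0; ring.
Qed.

Lemma matop_vshift M s z L i : supported 0 L z ->
  matop M (vshift s z) i = csum (fun j => Cmult (M i (s + j)%nat) (z j)) L.
Proof.
  intros Hz. rewrite (matop_csum _ _ _ (s + L)%nat).
  - rewrite csum_split, csum_zero, Cplus_0_l.
    + apply csum_ext; intros; now rewrite vshift_add.
    + intros j Hj; rewrite vshift_lt by auto; apply Cmult_0_r.
  - intros j Hj. replace j with (s + (j - s))%nat by lia.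
    rewrite vshift_add, Hz by lia. apply Cmult_0_r.
Qed.

Lemma vshift_of_window s y : (forall n, (n < s)%nat -> y n = RtoC 0) ->
  y = vshift s (fun i => y (s + i)%nat).
Proof.
  intros H; apply functional_extensionality; intros n.
  destruct (Nat.lt_ge_cases n s) as [Hn|Hn].
  - now rewrite H, vshift_lt.
  - replace n with (s + (n - s))%nat by lia. now rewrite vshift_add.
Qed.

Lemma lower_bound_on_transfer W K K' M M' N d : band W K M -> band W K' M' ->
  matching M M' (N + 2 * W) -> lower_bound_on M' N d -> lower_bound_on M N d.
Proof.
  intros HM HM' Hmatch HL k x Hx.
  (* The block reaches [W] beyond the support on each side, so it contains every row that [x] can
     reach. If truncated subtraction shortens the left margin, then [s = 0], hence [s' = 0], and no
     row is lost there. *)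
  set (s := (k - W)%nat). destruct (Hmatch s) as (s' & Hs' & Heq).
  set (L := (N + 2 * W)%nat) in *. set (a := (k - s)%nat).
  set (z := fun i => x (s + i)%nat).
  assert (Hz : supported a (a + N) z) by (intros i Hi; apply Hx; unfold a, s in *; lia).
  assert (HzL : supported 0 L z) by (intros i Hi; apply Hz; unfold a, s, L in *; lia).
  assert (Ex : x = vshift s z) by (apply vshift_of_window; intros; apply Hx; unfold s in *; lia).
  assert (Hx' : supported (s' + a) (s' + a + N) (vshift s' z)).
  { intros n Hn. destruct (Nat.lt_ge_cases n s') as [H|H]; [now apply vshift_lt|].
    replace n with (s' + (n - s'))%nat by lia. rewrite vshift_add. apply Hz; lia. }
  specialize (HL _ _ Hx'). rewrite Ex, nsq_vshift. rewrite nsq_vshift in HL.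
  apply Rle_trans with (1 := HL). right.
  rewrite (vshift_of_window s (matop M (vshift s z))), (vshift_of_window s' (matop M' (vshift s' z))).
  - rewrite !nsq_vshift. f_equal. apply functional_extensionality; intros i.
    rewrite !(matop_vshift _ _ z L) by auto. apply csum_ext; intros j Hj.
    destruct (Nat.lt_ge_cases i L) as [Hi|Hi]; [now rewrite Heq|].
    destruct (Nat.lt_ge_cases j (a + N)) as [Hj2|Hj2].
    + rewrite (band_zero W K' M'), (band_zero W K M) by (auto; unfold a, s, L in *; lia). auto.
    + rewrite Hz by lia. now rewrite !Cmult_0_r.
  - intros n Hn. rewrite (matop_vshift _ _ z L) by auto. apply csum_zero; intros j Hj.
    destruct (Nat.lt_ge_cases j a) as [Hj2|Hj2]; [rewrite Hz by lia; apply Cmult_0_r|].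
    rewrite (band_zero W K' M') by (auto; unfold a, s in *; lia). apply Cmult_0_l.
  - intros n Hn. rewrite (matop_vshift _ _ z L) by auto. apply csum_zero; intros j Hj.
    destruct (Nat.lt_ge_cases j a) as [Hj2|Hj2]; [rewrite Hz by lia; apply Cmult_0_r|].
    rewrite (band_zero W K M) by (auto; unfold a, s in *; lia). apply Cmult_0_l.
Qed.

Lemma matching_adjM M M' L : matching M M' L -> matching (adjM M) (adjM M') L.
Proof.
  intros H s; destruct (H s) as (s' & H1 & H2). exists s'; split; auto.
  intros; unfold adjM; f_equal; auto.
Qed.

Lemma matching_subId M M' L lam : matching M M' L -> matching (subId M lam) (subId M' lam) L.
Proof.
  intros H s; destruct (H s) as (s' & H1 & H2). exists s'; split; auto.
  intros i j Hi Hj; unfold subId. rewrite H2 by auto.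
  destruct (Nat.eqb_spec (s + i) (s + j)), (Nat.eqb_spec (s' + i) (s' + j)); auto; lia.
Qed.

Lemma bounded_below_transfer W K R0 d delta : 0 <= d -> 0 < delta ->
  exists L, forall M M' lam, band W K M -> band W K M' -> matching M M' L -> Cmod lam <= R0 ->
    bounded_below (subId M' lam) d -> bounded_below (subId M lam) (d - delta).
Proof.
  intros Hd Hdelta.
  (* The entry bound is raised to [K + R0] to put [subId M lam] into one band class for all
     admissible [lam]. *)
  destruct (lower_bound_localise W (K + R0) d delta Hd Hdelta) as [N HN].
  exists (N + 2 * W)%nat. intros M M' lam HM HM' Hmatch Hlam [H1 H2].
  assert (Hband : forall A, band W K A -> band W (K + R0) (subId A lam)).
  { intros A HA. destruct (band_subId W K A lam HA) as [Ha Hb]. split; [lra|].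
    intros i j. eapply Rle_trans; [apply Hb|]. apply Rmult_le_compat_r; [apply indic_nonneg|lra]. }
  assert (Hon : forall A e, band W (K + R0) A -> lower_bound A e -> lower_bound_on A N e).
  { intros A e HA HL s x Hx. apply HL. now apply l2_supported with s (s + N)%nat. }
  assert (Hm := matching_subId M M' _ lam Hmatch).
  split.
  - apply HN; auto.
    apply (lower_bound_on_transfer W (K + R0) (K + R0) _ (subId M' lam)); auto.
  - apply HN; [now apply band_adjM, Hband|].
    apply (lower_bound_on_transfer W (K + R0) (K + R0) _ (adjM (subId M' lam)));
      auto using band_adjM, matching_adjM.
Qed.

(** * Moving the spectral parameter *)

Lemma lower_bound_l2norm W K M e : band W K M -> 0 <= e ->
  lower_bound M (e ^ 2) <-> forall x, l2 x -> e * l2norm x <= l2norm (matop M x).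
Proof.
  intros HM He. split; intros H x Hx; specialize (H x Hx); assert (HMx := l2_matop W K M x HM Hx).
  - apply Rsqr_incr_0_var; [|apply l2norm_nonneg].
    rewrite !Rsqr_pow2, Rpow_mult_distr, !l2norm_sqr; auto.
  - rewrite <- !l2norm_sqr, <- Rpow_mult_distr by auto.
    apply pow_incr; split; auto. apply Rmult_le_pos; auto using l2norm_nonneg.
Qed.

Lemma subId_subId M lam z : subId (subId M lam) z = subId M (Cplus lam z).
Proof.
  apply functional_extensionality; intros i; apply functional_extensionality; intros j.
  unfold subId; destruct (Nat.eqb i j); auto. ring.
Qed.

Lemma bounded_below_adjM M d : bounded_below (adjM M) d <-> bounded_below M d.
Proof. unfold bounded_below; rewrite adjM_involutive; tauto. Qed.

Lemma lower_bound_perturb W K M lam e eta : band W K M -> 0 <= eta <= e -> Cmod lam <= eta ->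
  lower_bound M (e ^ 2) -> lower_bound (subId M lam) ((e - eta) ^ 2).
Proof.
  intros HM He Hlam HL.
  apply (lower_bound_l2norm W (K + Cmod lam)); [now apply band_subId|lra|].
  assert (He0 : 0 <= e) by lra.
  intros x Hx. assert (HLx := proj1 (lower_bound_l2norm W K M e HM He0) HL x Hx).
  assert (H2 := l2_matop W (K + Cmod lam) _ x (band_subId _ _ _ lam HM) Hx).
  assert (E : matop M x = vadd (matop (subId M lam) x) (vscal lam x)).
  { rewrite (matop_subId W K) by auto. apply functional_extensionality; intros i.
    unfold vadd, vscal. ring. }
  rewrite E in HLx.
  assert (H3 := l2norm_vadd _ _ H2 (l2_vscal lam x Hx)).
  rewrite l2norm_vscal in H3 by auto.
  assert (Cmod lam * l2norm x <= eta * l2norm x) by (apply Rmult_le_compat_r; auto using l2norm_nonneg).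
  lra.
Qed.

Lemma bounded_below_perturb W K M lam mu e eta : band W K M -> 0 <= eta <= e ->
  Cmod (Cminus mu lam) <= eta ->
  bounded_below (subId M lam) (e ^ 2) -> bounded_below (subId M mu) ((e - eta) ^ 2).
Proof.
  intros HM He Hd [H1 H2].
  replace (subId M mu) with (subId (subId M lam) (Cminus mu lam))
    by (rewrite subId_subId; f_equal; ring).
  assert (Hb := band_subId W K M lam HM).
  split.
  - eapply lower_bound_perturb; eauto.
  - rewrite adjM_subId. eapply lower_bound_perturb; eauto using band_adjM. now rewrite Cmod_conj.
Qed.

(** Confines the relevant spectral parameters to a disc common to the whole band class, where the
    transfer of lower bounds is uniform. *)
Lemma lower_bound_far W K M lam e : band W K M -> 0 <= e -> opbound W K + e <= Cmod lam ->
  lower_bound (subId M lam) (e ^ 2).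
Proof.
  intros HM He Hlam.
  apply (lower_bound_l2norm W (K + Cmod lam)); [now apply band_subId|lra|].
  intros x Hx. assert (HMx := l2_matop W K M x HM Hx).
  assert (H2 := l2_matop W (K + Cmod lam) _ x (band_subId _ _ _ lam HM) Hx).
  assert (E : vscal lam x = vadd (matop M x) (vscal (RtoC (-1)) (matop (subId M lam) x))).
  { rewrite (matop_subId W K) by auto. apply functional_extensionality; intros i.
    unfold vadd, vscal. apply injective_projections; simpl; ring. }
  assert (H3 := l2norm_vadd _ _ HMx (l2_vscal (RtoC (-1)) _ H2)).
  rewrite <- E, !l2norm_vscal, Cmod_R, Rabs_left in H3 by (auto; lra).
  assert (H4 := l2norm_matop W K M x HM Hx).
  assert ((opbound W K + e) * l2norm x <= Cmod lam * l2norm x)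
    by (apply Rmult_le_compat_r; auto using l2norm_nonneg).
  lra.
Qed.

Lemma bounded_below_far W K M lam e : band W K M -> 0 <= e -> opbound W K + e <= Cmod lam ->
  bounded_below (subId M lam) (e ^ 2).
Proof.
  intros HM He Hlam; split.
  - now apply (lower_bound_far W K).
  - rewrite adjM_subId. apply (lower_bound_far W K); auto using band_adjM. now rewrite Cmod_conj.
Qed.

Lemma not_lower_bound M d : ~ lower_bound M d -> exists x, l2 x /\ nsq (matop M x) < d * nsq x.
Proof.
  intros H. apply NNPP; intros Hn; apply H. intros x Hx. apply Rnot_lt_le; intros Hlt.
  apply Hn; eauto.
Qed.

(* The sign of [ip a (z^2 c)] is controlled by choosing [z] in [{r, i r}], then that of the
   terms odd in [z] by passing to [-z] if necessary. *)
Lemma nsq_quadratic_ge a b c r : l2 a -> l2 b -> l2 c -> 0 <= r ->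
  exists z, Cmod z = r /\
    nsq a + r ^ 2 * nsq b <= nsq (vadd a (vadd (vscal z b) (vscal (Cmult z z) c))).
Proof.
  intros Ha Hb Hc Hr.
  assert (Hz0 : exists z, Cmod z = r /\ 0 <= ip a (vscal (Cmult z z) c)).
  { destruct (Rle_dec 0 (ip a c)) as [H|H].
    - exists (RtoC r). split; [rewrite Cmod_R; now apply Rabs_pos_eq|].
      rewrite <- RtoC_mult, ip_vscal_r. apply Rmult_le_pos; nra.
    - exists (Cmult Ci (RtoC r)). split.
      + rewrite Cmod_mult, Cmod_R, Rabs_pos_eq by auto.
        replace (Cmod Ci) with 1; [ring|]. unfold Cmod, Ci; simpl.
        replace (0 * (0 * 1) + 1 * (1 * 1)) with 1 by ring. now rewrite sqrt_1.
      + replace (Cmult _ _) with (RtoC (- (r * r)))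
          by (apply injective_projections; simpl; ring).
        rewrite ip_vscal_r. nra. }
  destruct Hz0 as (z0 & Hz0 & Heven).
  assert (Hz : exists z, Cmod z = r /\ 0 <= ip a (vscal (Cmult z z) c)
     /\ 0 <= ip a (vscal z b) + ip (vscal z b) (vscal (Cmult z z) c)).
  { destruct (Rle_dec 0 (ip a (vscal z0 b) + ip (vscal z0 b) (vscal (Cmult z0 z0) c))) as [H|H];
      [now exists z0|].
    exists (Copp z0). split; [now rewrite Cmod_opp|].
    replace (Cmult (Copp z0) (Copp z0)) with (Cmult z0 z0) by ring.
    replace (vscal (Copp z0) b) with (vscal (RtoC (-1)) (vscal z0 b)).
    - rewrite ip_vscal_r, ip_vscal_l. split; auto. lra.
    - apply functional_extensionality; intros i; unfold vscal. apply injective_projections; simpl; ring. }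
  destruct Hz as (z & Hz & H1 & H2). exists z; split; auto.
  assert (Hc2 : 0 <= nsq (vscal (Cmult z z) c)) by auto using nsq_nonneg, l2_vscal.
  rewrite nsq_vadd, nsq_vadd, ip_vadd_r, nsq_vscal, Hz by auto using l2_vadd, l2_vscal.
  lra.
Qed.

(* With [u = M^2 y] and [v = M^2 y + z M y + z^2 y] one has [(M - z) v = M u - z^3 y]; this
   is a quantitative form of the fact that the resolvent norm has no local maximum. *)
Lemma lower_bound_growth W K M e s r g u : band W K M -> 0 < e -> bounded_below M (e ^ 2) ->
  0 < r -> 0 <= s -> 0 <= g -> l2 u -> 0 < nsq u -> nsq (matop M u) <= s ^ 2 * nsq u ->
  (forall y, l2 y -> matop M (matop M y) = u -> g * nsq u <= nsq (matop M y)) ->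
  exists z, Cmod z = r /\
    forall d, 0 <= d -> lower_bound (subId M z) d -> d * (1 + r ^ 2 * g) <= (s + r ^ 3 / e ^ 2) ^ 2.
Proof.
  intros HM He [HL HLs] Hr Hs Hg Hu Hu0 Hsu Hgy.
  assert (He2 : 0 < e ^ 2) by now apply pow_lt.
  destruct (surjective_of_lower_bound_adj W K M _ HM He2 HLs u Hu) as (b & Hb & Eb).
  destruct (surjective_of_lower_bound_adj W K M _ HM He2 HLs b Hb) as (y & Hy & Ey).
  specialize (Hgy y Hy). rewrite Ey in Hgy. specialize (Hgy Eb).
  destruct (nsq_quadratic_ge u b y r Hu Hb Hy (Rlt_le _ _ Hr)) as (z & Hz & Hv).
  set (v := vadd u _) in Hv. exists z; split; auto. intros d Hd HLz.
  assert (Hv2 : l2 v) by (unfold v; auto using l2_vadd, l2_vscal).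
  specialize (HLz v Hv2).
  assert (E : matop (subId M z) v = vadd (matop M u) (vscal (Copp (Cmult z (Cmult z z))) y)).
  { rewrite (matop_subId W K) by auto. unfold v.
    rewrite !(matop_vadd W K), !(matop_vscal W K), Eb, Ey by auto.
    apply functional_extensionality; intros i; unfold vadd, vscal. ring. }
  rewrite E in HLz.
  assert (HMu := l2_matop W K M u HM Hu).
  (* Since [u = M^2 y], the lower bound [e] is used twice. *)
  assert (Hyu : l2norm y <= / e ^ 2 * l2norm u).
  { apply nsq_le_l2norm; auto; [now apply Rlt_le, Rinv_0_lt_compat|].
    assert (H1 := HL y Hy). assert (H2 := HL b Hb). rewrite Ey in H1. rewrite Eb in H2.
    apply Rmult_le_reg_l with ((e ^ 2) ^ 2); [now apply pow_lt|].
    replace ((e ^ 2) ^ 2 * ((/ e ^ 2) ^ 2 * nsq u)) with (nsq u) by (field; lra).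
    apply Rle_trans with (e ^ 2 * nsq b); auto.
    replace ((e ^ 2) ^ 2 * nsq y) with (e ^ 2 * (e ^ 2 * nsq y)) by ring.
    apply Rmult_le_compat_l; lra. }
  assert (Hnum : nsq (vadd (matop M u) (vscal (Copp (Cmult z (Cmult z z))) y))
    <= (s + r ^ 3 / e ^ 2) ^ 2 * nsq u).
  { assert (0 < r ^ 3 / e ^ 2) by (apply Rdiv_lt_0_compat; auto; now apply pow_lt).
    apply nsq_le_l2norm; auto using l2_vadd, l2_vscal; [lra|].
    eapply Rle_trans; [apply l2norm_vadd; auto using l2_vscal|].
    rewrite l2norm_vscal, Cmod_opp, !Cmod_mult, Hz by auto.
    apply nsq_le_l2norm in Hsu; auto.
    assert (r * (r * r) * l2norm y <= r * (r * r) * (/ e ^ 2 * l2norm u)).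
    { apply Rmult_le_compat_l; auto. repeat apply Rmult_le_pos; lra. }
    unfold Rdiv. simpl pow in *. lra. }
  apply Rmult_le_reg_r with (nsq u); auto.
  apply Rle_trans with (2 := Hnum), Rle_trans with (2 := HLz).
  rewrite Rmult_assoc. apply Rmult_le_compat_l; auto.
  apply Rle_trans with (2 := Hv).
  assert (r ^ 2 * (g * nsq u) <= r ^ 2 * nsq b) by (apply Rmult_le_compat_l; auto using pow2_ge_0).
  lra.
Qed.

(** Without normality, the only estimate of [matop M y] from below comes from |u| = |M (M y)| being
    at most k |M y|, so the gain constant is [/ k ^ 2]. *)
Lemma lower_bound_step W K M lam k e s r : band W K M -> 0 < k -> opbound W (K + Cmod lam) <= k ->
  0 < e -> 0 <= s -> 0 < r -> (s + r ^ 3 / e ^ 2) ^ 2 < e ^ 2 * (1 + r ^ 2 / k ^ 2) ->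
  bounded_below (subId M lam) (e ^ 2) -> ~ lower_bound (subId M lam) (s ^ 2) ->
  exists z, Cmod z = r /\ ~ lower_bound (subId M (Cplus lam z)) (e ^ 2).
Proof.
  intros HM Hk Hlam He Hs Hr Hnum Hbb Hn.
  destruct (not_lower_bound _ _ Hn) as (u & Hu & Hlt).
  assert (Hband := band_subId W K M lam HM).
  assert (Hk2 : 0 < k ^ 2) by now apply pow_lt.
  assert (Hu0 : 0 < nsq u).
  { assert (H1 := nsq_nonneg _ (l2_matop _ _ _ u Hband Hu)). assert (H2 := nsq_nonneg u Hu).
    destruct H2 as [H2|H2]; auto. rewrite <- H2 in Hlt. lra. }
  destruct (lower_bound_growth _ _ _ e s r (/ k ^ 2) u Hband He Hbb Hr Hs) as (z & Hz & H); auto.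
  - now apply Rlt_le, Rinv_0_lt_compat.
  - lra.
  - intros y Hy Ey. apply Rmult_le_reg_l with (k ^ 2); auto.
    rewrite <- Rmult_assoc, Rinv_r, Rmult_1_l, <- Ey by lra.
    assert (HMy := l2_matop _ _ _ y Hband Hy).
    eapply Rle_trans; [apply (band_bounded _ _ _ _ Hband HMy)|].
    apply Rmult_le_compat_r; [now apply nsq_nonneg|].
    apply pow_incr; split; auto. now apply opbound_nonneg with (subId M lam).
  - exists z; split; auto. intros HL. rewrite <- subId_subId in HL.
    specialize (H (e ^ 2) (pow2_ge_0 e) HL). unfold Rdiv in *. lra.
Qed.

Lemma Cminus_plus_l lam z : Cminus (Cplus lam z) lam = z.
Proof. ring. Qed.

(** The uniform form of the absence of plateaus: the slack [delta], fixed before [M] and [lam], can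
    be recovered by moving the parameter by at most [eta]. *)
Lemma not_bounded_below_step W K R0 e eta : 0 <= K -> 0 <= R0 -> 0 < e -> 0 < eta ->
  exists delta, 0 < delta <= 1 /\ forall M lam, band W K M -> Cmod lam <= R0 ->
    ~ bounded_below (subId M lam) ((e + delta) ^ 2) ->
    exists mu, Cmod (Cminus mu lam) <= eta /\ ~ bounded_below (subId M mu) (e ^ 2).
Proof.
  intros HK HR0 He Heta.
  set (k := opbound W (K + R0) + 1).
  assert (Hk0 : 0 <= opbound W (K + R0)) by (apply Rmult_le_pos; [lra|apply pos_INR]).
  assert (Hk : 0 < k) by (unfold k; lra).
  (* The gain is [e ^ 2 * r ^ 2 / k ^ 2] and the error term is [p = r ^ 3 / e ^ 2]; the last bound
     on [r] makes the gain at least [4 * p * e], and [r <= e] gives [p <= e]. *)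
  set (r := Rmin eta (Rmin e (e ^ 3 / (4 * k ^ 2)))).
  assert (He3 : 0 < e ^ 3 / (4 * k ^ 2)).
  { apply Rdiv_lt_0_compat; [now apply pow_lt|]. apply Rmult_lt_0_compat; [lra|now apply pow_lt]. }
  assert (Hr : 0 < r) by (unfold r; repeat apply Rmin_glb_lt; auto).
  assert (Hr1 : r <= eta) by apply Rmin_l.
  assert (Hr2 : r <= e) by (eapply Rle_trans; [apply Rmin_r|apply Rmin_l]).
  assert (Hr3 : r <= e ^ 3 / (4 * k ^ 2)) by (eapply Rle_trans; [apply Rmin_r|apply Rmin_r]).
  set (p := r ^ 3 / e ^ 2).
  assert (Hp : 0 < p) by (apply Rdiv_lt_0_compat; now apply pow_lt).
  assert (Hpe : p <= e).
  { unfold p. apply Rle_div_l; [now apply pow_lt|].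
    replace (e * e ^ 2) with (e ^ 3) by ring. apply pow_incr; lra. }
  assert (Hpk : 4 * p * e <= e ^ 2 * (r ^ 2 / k ^ 2)).
  { replace (4 * p * e) with (r ^ 2 * 4 * r / e) by (unfold p; field; lra).
    replace (e ^ 2 * (r ^ 2 / k ^ 2)) with (r ^ 2 * 4 * (e ^ 3 / (4 * k ^ 2)) / e) by (field; lra).
    apply Rmult_le_compat_r; [now apply Rlt_le, Rinv_0_lt_compat|].
    apply Rmult_le_compat_l; auto. generalize (pow2_ge_0 r); lra. }
  (* Expanding [(e + delta + p) ^ 2], the terms without [delta] exceed [e ^ 2] by at most
     [3 * p * e] and those with [delta] add at most [p * e / 2], which stays below the gain. *)
  set (delta := Rmin 1 (p * e / (2 * (2 * e + 2 * p + 1)))).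
  assert (Hpe0 : 0 < p * e) by now apply Rmult_lt_0_compat.
  assert (Hdelta : 0 < delta).
  { apply Rmin_glb_lt; [lra|]. apply Rdiv_lt_0_compat; lra. }
  assert (Hd1 : delta <= 1) by apply Rmin_l.
  assert (Hd2 : delta * (2 * e + 2 * p + 1) <= p * e / 2).
  { apply Rle_trans with (p * e / (2 * (2 * e + 2 * p + 1)) * (2 * e + 2 * p + 1)).
    - apply Rmult_le_compat_r; [lra|apply Rmin_r].
    - right; field; lra. }
  assert (Hnum : (e + delta + r ^ 3 / e ^ 2) ^ 2 < e ^ 2 * (1 + r ^ 2 / k ^ 2)).
  { fold p. nra. }
  exists delta; split; [lra|]. intros M lam HM Hlam Hn.
  destruct (classic (bounded_below (subId M lam) (e ^ 2))) as [Hbb|Hbb].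
  2:{ exists lam; split; auto. replace (Cminus lam lam) with (RtoC 0) by ring. rewrite Cmod_0; lra. }
  assert (Hkl : opbound W (K + Cmod lam) <= k).
  { unfold k. apply Rle_trans with (opbound W (K + R0)); [|lra].
    apply Rmult_le_compat_r; [apply pos_INR|lra]. }
  apply not_and_or in Hn. destruct Hn as [Hn|Hn].
  - destruct (lower_bound_step W K M lam k e (e + delta) r) as (z & Hz & Hz2); auto; [lra|].
    exists (Cplus lam z). rewrite Cminus_plus_l, Hz. split; auto. intros [H _]; auto.
  (* If the bound fails for the adjoint, the step is made there and the displacement is conjugated
     back. *)
  - rewrite adjM_subId in Hn.
    destruct (lower_bound_step W K (adjM M) (Cconj lam) k e (e + delta) r) as (z & Hz & Hz2);
      auto using band_adjM; [now rewrite Cmod_conj|lra| |].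
    { rewrite <- adjM_subId. now apply bounded_below_adjM. }
    exists (Cplus lam (Cconj z)). rewrite Cminus_plus_l, Cmod_conj, Hz. split; auto.
    intros [_ H]. apply Hz2. rewrite adjM_subId, Cplus_conj, Cconj_conj in H. exact H.
Qed.

Lemma lower_bound_closed W K M e : band W K M -> 0 < e ->
  (forall e', 0 <= e' < e -> lower_bound M (e' ^ 2)) -> lower_bound M (e ^ 2).
Proof.
  intros HM He H. apply (lower_bound_l2norm W K); auto; [lra|]. intros x Hx.
  assert (Hn : forall e', 0 <= e' < e -> e' * l2norm x <= l2norm (matop M x)).
  { intros e' He'. apply (lower_bound_l2norm W K); auto. lra. }
  assert (Hp := l2norm_nonneg x). assert (Hq := l2norm_nonneg (matop M x)).
  set (p := l2norm x) in *. set (q := l2norm (matop M x)) in *.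
  apply Rnot_lt_le; intros Hlt.
  assert (Hp0 : 0 < p) by (destruct Hp as [|Hp]; auto; rewrite <- Hp in Hlt; lra).
  assert (Hqp : 0 <= q / p) by (apply Rmult_le_pos; auto; now apply Rlt_le, Rinv_0_lt_compat).
  assert (Hqe : q / p < e) by (apply Rlt_div_l; lra).
  specialize (Hn ((e + q / p) / 2)).
  assert (E : (e + q / p) / 2 * p = (e * p + q) / 2) by (field; lra).
  rewrite E in Hn. lra.
Qed.

(** If the level [e] held everywhere, there would be a largest level [s] that holds everywhere. By
    the step lemma inside a disc and by [bounded_below_far] outside it, [s + delta] would hold
    everywhere too. *)
Lemma not_bounded_below_exists W K M e : band W K M -> 0 < e ->
  exists lam, ~ bounded_below (subId M lam) (e ^ 2).
Proof.
  intros HM He. apply NNPP; intros Hn.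
  assert (Hall : forall lam, bounded_below (subId M lam) (e ^ 2)).
  { intros lam. apply NNPP; intros H; apply Hn; eauto. }
  set (E := fun s => 0 <= s /\ forall lam, bounded_below (subId M lam) (s ^ 2)).
  destruct (completeness E) as [s [Hub Hlub]].
  (* The levels are bounded: at the parameter 0 a lower bound cannot exceed the operator norm, as
     testing on the unit vector [delta0] shows. *)
  - exists (opbound W (K + Cmod (RtoC 0))). intros s [Hs H].
    destruct (H (RtoC 0)) as [HL _].
    assert (Hband := band_subId W K M (RtoC 0) HM).
    assert (HLe := proj1 (lower_bound_l2norm _ _ _ _ Hband Hs) HL delta0 l2_delta0).
    assert (H2 := l2norm_matop _ _ _ delta0 Hband l2_delta0).
    assert (He1 : l2norm delta0 = 1) by (unfold l2norm; fold (nsq delta0); rewrite nsq_delta0; apply sqrt_1).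
    rewrite He1 in *. lra.
  - exists e; split; [lra|auto].
  - assert (Hes : e <= s) by (apply Hub; split; [lra|auto]).
    assert (Hs : 0 < s) by lra.
    assert (Hbelow : forall s', 0 <= s' < s -> forall lam, bounded_below (subId M lam) (s' ^ 2)).
    { intros s' Hs' lam. apply NNPP; intros Hc.
      assert (s <= s'); [|lra]. apply Hlub. intros t [Ht1 Ht2].
      apply Rnot_lt_le; intros Hlt. apply Hc.
      apply bounded_below_mono with (t ^ 2); [apply pow_incr; lra|auto]. }
    assert (Hat : forall lam, bounded_below (subId M lam) (s ^ 2)).
    { intros lam. assert (Hband := band_subId W K M lam HM).
      split.
      - apply (lower_bound_closed _ _ _ _ Hband Hs).
        intros s' Hs'; exact (proj1 (Hbelow s' Hs' lam)).
      - apply (lower_bound_closed _ _ _ _ (band_adjM _ _ _ Hband) Hs).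
        intros s' Hs'; exact (proj2 (Hbelow s' Hs' lam)). }
    (* The summand 1 accounts for [delta <= 1]: outside this disc even the level [s + delta]
       holds. *)
    set (R0 := opbound W K + s + 1).
    assert (HR0 : 0 <= R0) by (generalize (opbound_nonneg W K M HM); unfold R0; lra).
    destruct (not_bounded_below_step W K R0 s 1 (proj1 HM) HR0 Hs Rlt_0_1) as (delta & Hd & Hstep).
    destruct (classic (forall lam, bounded_below (subId M lam) ((s + delta) ^ 2))) as [H|H].
    + assert (s + delta <= s); [|lra]. apply Hub; split; [lra|auto].
    + apply not_all_ex_not in H. destruct H as [lam Hlam].
      destruct (Hstep M lam HM) as (mu & _ & Hmu); auto.
      apply Rnot_lt_le; intros Hfar. apply Hlam, (bounded_below_far W K); auto; [lra|].
      unfold R0 in Hfar; lra.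
Qed.

(** * Normal matrices *)

(** Normality gives equal norms for [M] and its adjoint; the shift by [lam] preserves this because
    the cross terms of the two expanded squares coincide. *)
Lemma normal_nsq_adjM W K M lam x : band W K M -> normalM M -> l2 x ->
  nsq (matop (adjM (subId M lam)) x) = nsq (matop (subId M lam) x).
Proof.
  intros HM HN Hx. assert (HMs := band_adjM _ _ _ HM).
  assert (HMx := l2_matop W K M x HM Hx). assert (HMsx := l2_matop W K _ x HMs Hx).
  assert (E0 : nsq (matop M x) = nsq (matop (adjM M) x)).
  { rewrite !nsq_ip, (ip_matop W K), <- (HN x Hx) by auto.
    rewrite ip_sym, (ip_matop W K) by auto. reflexivity. }
  assert (E1 : ip (matop (adjM M) x) (vscal (Copp (Cconj lam)) x) = ip (matop M x) (vscal (Copp lam) x)).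
  { rewrite (ip_matop W K), adjM_involutive, (matop_vscal W K) by auto using l2_vscal.
    replace (Copp (Cconj lam)) with (Cconj (Copp lam)) by (apply injective_projections; simpl; ring).
    now rewrite <- ip_vscal_conj, ip_sym. }
  rewrite adjM_subId, !(matop_subId W K), !nsq_vadd, E0, E1, !nsq_vscal, !Cmod_opp, Cmod_conj
    by auto using l2_vscal.
  reflexivity.
Qed.

Lemma normal_bounded_below W K M lam d : band W K M -> normalM M ->
  lower_bound (subId M lam) d -> bounded_below (subId M lam) d.
Proof.
  intros HM HN H; split; auto. intros x Hx.
  rewrite (normal_nsq_adjM W K) by auto. now apply H.
Qed.

(* For normal [T] one has [|T x|^2 <= |x| |T^2 x|], so the growth lemma increases the
   resolvent norm by a factor independent of the position. *)
Lemma normal_step W K M lam s : band W K M -> normalM M -> 0 < s ->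
  ~ bounded_below (subId M lam) (s ^ 2) ->
  exists mu, Cmod (Cminus mu lam) <= s / 4 /\ ~ bounded_below (subId M mu) ((199 / 200 * s) ^ 2).
Proof.
  intros HM HN Hs Hn. set (e := 199 / 200 * s). assert (He : 0 < e) by (unfold e; lra).
  destruct (classic (bounded_below (subId M lam) (e ^ 2))) as [Hbb|Hbb].
  2:{ exists lam; split; auto. replace (Cminus lam lam) with (RtoC 0) by ring. rewrite Cmod_0; lra. }
  assert (Hnl : ~ lower_bound (subId M lam) (s ^ 2)).
  { intros H; apply Hn. now apply (normal_bounded_below W K). }
  destruct (not_lower_bound _ _ Hnl) as (u & Hu & Hlt).
  assert (Hband := band_subId W K M lam HM).
  assert (HTu := l2_matop _ _ _ u Hband Hu).
  assert (Hu0 : 0 < nsq u).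
  { assert (H1 := nsq_nonneg _ HTu). assert (H2 := nsq_nonneg u Hu).
    destruct H2 as [H2|H2]; auto. rewrite <- H2 in Hlt. lra. }
  assert (Hs2 : 0 < s ^ 2) by now apply pow_lt.
  destruct (lower_bound_growth _ _ _ e s (s / 4) (/ s ^ 2) u Hband He Hbb) as (z & Hz & H); auto; try lra.
  - now apply Rlt_le, Rinv_0_lt_compat.
  - intros y Hy Ey. set (v := matop (subId M lam) y) in *.
    assert (Hv : l2 v) by now apply (l2_matop _ _ _ y Hband).
    (* With T the shifted matrix and u = T v, |u|^2 = (v, T^* u) is at most |v| |T^* u| = |v| |T u|.
       As |T u| is at most s |u|, this gives the gain constant [/ s ^ 2], free of the norm of
       [M]. *)
    assert (H1 : nsq u <= l2norm v * l2norm (matop (subId M lam) u)).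
    { rewrite nsq_ip. rewrite <- Ey at 1. rewrite (ip_matop _ _ _ _ _ Hband) by auto.
      assert (Hadj := l2_matop _ _ _ u (band_adjM _ _ _ Hband) Hu).
      eapply Rle_trans; [now apply ip_le_norms|].
      unfold l2norm at 2 4; fold (nsq (matop (adjM (subId M lam)) u)) (nsq (matop (subId M lam) u)).
      rewrite (normal_nsq_adjM W K); auto. lra. }
    assert (H2 : l2norm (matop (subId M lam) u) <= s * l2norm u) by (apply nsq_le_l2norm; auto; lra).
    assert (H3 : l2norm u <= s * l2norm v).
    { assert (Hp : 0 < l2norm u) by now apply sqrt_lt_R0.
      apply Rmult_le_reg_r with (l2norm u); auto.
      replace (l2norm u * l2norm u) with (nsq u) by (rewrite <- l2norm_sqr by auto; ring).
      apply Rle_trans with (1 := H1).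
      replace (s * l2norm v * l2norm u) with (l2norm v * (s * l2norm u)) by ring.
      apply Rmult_le_compat_l; auto using l2norm_nonneg. }
    apply nsq_le_l2norm in H3; auto; [|lra].
    apply Rmult_le_reg_l with (s ^ 2); auto.
    rewrite <- Rmult_assoc, Rinv_r, Rmult_1_l by lra. exact H3.
  - exists (Cplus lam z). rewrite Cminus_plus_l, Hz. split; [lra|]. intros [HL _].
    rewrite <- subId_subId in HL. specialize (H (e ^ 2) (pow2_ge_0 e) HL).
    (* After scaling by [s] the claim is numerical: with radius [s / 4] and ratio 199/200, the left
       side is about 1.052 and the right side about 1.032. *)
    replace (s + (s / 4) ^ 3 / e ^ 2) with (s * (1 + 625 / 39601)) in H by (unfold e; field; lra).
    replace (e ^ 2 * (1 + (s / 4) ^ 2 * / s ^ 2)) with (s ^ 2 * ((199 / 200) ^ 2 * (17 / 16))) in H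
      by (unfold e; field; lra).
    rewrite Rpow_mult_distr in H. apply Rmult_le_reg_l in H; auto. lra.
Qed.

(** * Limits of sequences with geometrically decreasing steps, and the spectrum of a normal
    matrix *)

Lemma Cmod_le_abs z : Cmod z <= Rabs (fst z) + Rabs (snd z).
Proof.
  destruct z as [a b]; simpl.
  replace (a, b) with (Cplus (RtoC a) (Cmult Ci (RtoC b)))
    by (apply injective_projections; simpl; ring).
  eapply Rle_trans; [apply Cmod_triangle|]. rewrite Cmod_mult, !Cmod_R.
  replace (Cmod Ci) with 1; [lra|]. unfold Cmod, Ci; simpl.
  replace (0 * (0 * 1) + 1 * (1 * 1)) with 1 by ring. now rewrite sqrt_1.
Qed.

Lemma ex_lim_geometric (u : nat -> R) c q : 0 <= q < 1 ->
  (forall n, Rabs (u (S n) - u n) <= c * q ^ n) -> ex_finite_lim_seq u.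
Proof.
  intros Hq Hu.
  assert (Hs : ex_series (fun n => u (S n) - u n)).
  { apply (ex_series_le (V := R_CompleteNormedModule)) with (fun n => c * q ^ n); [exact Hu|].
    apply (ex_series_scal (V := R_NormedModule)), ex_series_geom. rewrite Rabs_pos_eq; lra. }
  apply Series_correct, is_series_psum in Hs. set (l := Series _) in Hs.
  exists (u O + l). apply (is_lim_seq_ext (fun n => u O + psum (fun n => u (S n) - u n) n)).
  - intros n; induction n as [|n IH]; simpl; lra.
  - apply is_lim_seq_plus'; [apply is_lim_seq_const|exact Hs].
Qed.

Lemma C_geometric_limit (u : nat -> C) c q : 0 <= q < 1 ->
  (forall n, Cmod (Cminus (u (S n)) (u n)) <= c * q ^ n) ->
  exists l, Cmod (Cminus l (u O)) <= c * / (1 - q) /\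
    forall eta, 0 < eta -> eventually (fun n => Cmod (Cminus l (u n)) < eta).
Proof.
  intros Hq Hu.
  destruct (ex_lim_geometric (fun n => fst (u n)) c q Hq) as [a Ha].
  { intros n; apply Rle_trans with (2 := Hu n).
    apply Rle_trans with (2 := Rmax_Cmod _), Rmax_l. }
  destruct (ex_lim_geometric (fun n => snd (u n)) c q Hq) as [b Hb].
  { intros n; apply Rle_trans with (2 := Hu n).
    apply Rle_trans with (2 := Rmax_Cmod _), Rmax_r. }
  assert (Hlim : forall eta, 0 < eta -> eventually (fun n => Cmod (Cminus (a, b) (u n)) < eta)).
  { intros eta Heta. assert (H2 : 0 < eta / 2) by lra.
    apply is_lim_seq_spec in Ha; apply is_lim_seq_spec in Hb.
    destruct (Ha (mkposreal _ H2)) as [n1 H1], (Hb (mkposreal _ H2)) as [n2 H3].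
    exists (n1 + n2)%nat; intros n Hn.
    specialize (H1 n ltac:(lia)); specialize (H3 n ltac:(lia)). cbn [pos] in *.
    eapply Rle_lt_trans; [apply Cmod_le_abs|]. simpl.
    rewrite <- (Rabs_Ropp (a + _)), <- (Rabs_Ropp (b + _)).
    replace (- (a + - fst (u n))) with (fst (u n) - a) by ring.
    replace (- (b + - snd (u n))) with (snd (u n) - b) by ring. lra. }
  exists (a, b). split; auto.
  apply Rle_of_lt_all; intros eta Heta.
  destruct (Hlim eta Heta) as [n Hn]. specialize (Hn n (le_n n)).
  assert (Hd : forall m, Cmod (Cminus (u m) (u O)) <= c * psum (pow q) m).
  { induction m as [|m IH]; simpl.
    - replace (Cminus (u O) (u O)) with (RtoC 0) by ring. rewrite Cmod_0; lra.
    - replace (Cminus (u (S m)) (u O)) with (Cplus (Cminus (u (S m)) (u m)) (Cminus (u m) (u O))) by ring.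
      eapply Rle_trans; [apply Cmod_triangle|]. specialize (Hu m). lra. }
  specialize (Hd n).
  assert (Hc : 0 <= c) by (specialize (Hu O); generalize (Cmod_ge_0 (Cminus (u 1%nat) (u O))); simpl in Hu; lra).
  assert (c * psum (pow q) n <= c * / (1 - q)) by (apply Rmult_le_compat_l; auto; now apply psum_geom).
  replace (Cminus (a, b) (u O)) with (Cplus (Cminus (a, b) (u n)) (Cminus (u n) (u O))) by ring.
  eapply Rle_trans; [apply Cmod_triangle|]. lra.
Qed.

Lemma spectrum_iff W K M lam : band W K M ->
  spectrum M lam <-> forall e, 0 < e -> ~ bounded_below (subId M lam) (e ^ 2).
Proof.
  intros HM. assert (Hband := band_subId W K M lam HM). unfold spectrum. split.
  - intros Hs e He H. apply Hs. now apply (is_inverse_of_bounded_below _ _ _ e Hband).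
  - intros H [B HB]. destruct HB as (H1 & [k Hk] & H3).
    (* The bound [k] supplied by [is_inverse] may be zero or negative, so it is enlarged before
       being inverted. *)
    assert (Hk0 : 0 < Rabs k + 1) by (generalize (Rabs_pos k); lra).
    apply (H (/ (Rabs k + 1))); [now apply Rinv_0_lt_compat|].
    apply (bounded_below_of_inverse _ _ _ B _ Hband); [now apply Rinv_0_lt_compat| |].
    + split; eauto.
    + intros y Hy. apply Rmult_le_reg_l with (Rabs k + 1); auto.
      rewrite <- Rmult_assoc, Rinv_r, Rmult_1_l by lra.
      apply Rle_trans with (1 := Hk y Hy), Rmult_le_compat_r; [apply l2norm_nonneg|].
      generalize (Rle_abs k); lra.
Qed.

Lemma normal_spectrum_near W K M lam s : band W K M -> normalM M -> 0 < s ->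
  ~ bounded_below (subId M lam) (s ^ 2) ->
  exists mu, Cmod (Cminus mu lam) <= 50 * s /\ spectrum M mu.
Proof.
  intros HM HN Hs Hlam. set (q := 199 / 200).
  set (good := fun mu t mu' => Cmod (Cminus mu' mu) <= t / 4 /\ ~ bounded_below (subId M mu') ((q * t) ^ 2)).
  set (u := fix u n := match n with
    | O => lam | S n => epsilon (inhabits lam) (good (u n) (s * q ^ n)) end).
  assert (Hq : 0 < q < 1) by (unfold q; lra).
  assert (Hpos : forall n, 0 < s * q ^ n) by (intros; apply Rmult_lt_0_compat; auto; apply pow_lt; lra).
  assert (Hu : forall n, ~ bounded_below (subId M (u n)) ((s * q ^ n) ^ 2)
                      /\ good (u n) (s * q ^ n) (u (S n))).
  { induction n as [|n [IH1 IH2]].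
    - assert (H0 : ~ bounded_below (subId M (u O)) ((s * q ^ 0) ^ 2)) by (simpl in *; now rewrite Rmult_1_r).
      split; auto. simpl u. apply epsilon_spec. now apply (normal_step W K).
    - assert (H0 : ~ bounded_below (subId M (u (S n))) ((s * q ^ S n) ^ 2)).
      { replace (s * q ^ S n) with (q * (s * q ^ n)) by (simpl; ring). apply IH2. }
      split; auto. change (u (S (S n))) with (epsilon (inhabits lam) (good (u (S n)) (s * q ^ S n))).
      apply epsilon_spec. now apply (normal_step W K). }
  destruct (C_geometric_limit u (s / 4) q) as (mu & Hmu & Hlim); [lra| |].
  { intros n. destruct (Hu n) as [_ [H _]]. lra. }
  exists mu. split.
  (* The steps [s / 4 * q ^ n] sum to [s / 4 * 200], which is the constant 50. *)
  - eapply Rle_trans; [exact Hmu|]. right. unfold q. field.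
  - apply (spectrum_iff W K); auto. intros e He Hbb.
    (* A lower bound [e] at the limit would give [e / 2] at every point within [e / 2], but the
       levels [s * q ^ n] that fail along the sequence tend to 0. *)
    destruct (Hlim (e / 2)) as [n1 H1]; [lra|].
    assert (Hz : is_lim_seq (fun n => s * q ^ n) 0).
    { replace 0 with (s * 0) by ring. apply is_lim_seq_mult'; [apply is_lim_seq_const|].
      apply is_lim_seq_geom. rewrite Rabs_pos_eq; lra. }
    apply is_lim_seq_spec in Hz. assert (He2 : 0 < e / 2) by lra.
    destruct (Hz (mkposreal _ He2)) as [n2 H2].
    specialize (H1 (n1 + n2)%nat ltac:(lia)). specialize (H2 (n1 + n2)%nat ltac:(lia)). cbn [pos] in H2.
    destruct (Hu (n1 + n2)%nat) as [Hn _]. set (n := (n1 + n2)%nat) in *.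
    rewrite Rminus_0_r, Rabs_pos_eq in H2 by now apply Rlt_le.
    apply Hn. apply bounded_below_mono with ((e - e / 2) ^ 2).
    + apply pow_incr. specialize (Hpos n); lra.
    + apply (bounded_below_perturb W K M mu); auto; [lra|].
      replace (Cminus (u n) mu) with (Copp (Cminus mu (u n))) by ring. rewrite Cmod_opp. lra.
Qed.

(** * Convergence *)

Definition locally_convergent (Ms : nat -> nat -> nat -> C) (M : nat -> nat -> C) : Prop :=
  forall L, exists m0, forall m, (m0 <= m)%nat -> matching (Ms m) M L /\ matching M (Ms m) L.

Lemma bounded_below_eventually W K Ms M R0 d d' :
  (forall m, band W K (Ms m)) -> band W K M -> locally_convergent Ms M ->
  0 <= d -> d' < d -> exists m0, forall m lam, (m0 <= m)%nat -> Cmod lam <= R0 ->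
    (bounded_below (subId M lam) d -> bounded_below (subId (Ms m) lam) d')
    /\ (bounded_below (subId (Ms m) lam) d -> bounded_below (subId M lam) d').
Proof.
  intros HMs HM Hloc Hd Hd'. assert (Hdelta : 0 < d - d') by lra.
  destruct (bounded_below_transfer W K R0 d (d - d') Hd Hdelta) as [L HL].
  destruct (Hloc L) as [m0 Hm0]. exists m0; intros m lam Hm Hlam.
  destruct (Hm0 m Hm) as [H1 H2].
  replace d' with (d - (d - d')) by ring. split; apply HL; auto.
Qed.

Lemma resnorm_le_eventually W K Ms M lam a a' :
  (forall m, band W K (Ms m)) -> band W K M -> locally_convergent Ms M -> 0 < a < a' ->
  exists m0, forall m, (m0 <= m)%nat ->
    (Rbar_le (resnorm (matop (subId M lam))) a -> Rbar_le (resnorm (matop (subId (Ms m) lam))) a')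
    /\ (Rbar_le (resnorm (matop (subId (Ms m) lam))) a -> Rbar_le (resnorm (matop (subId M lam))) a').
Proof.
  intros HMs HM Hloc Ha.
  assert (H1 : 0 < / a') by (apply Rinv_0_lt_compat; lra).
  assert (H2 : / a' < / a) by (apply Rinv_lt_contravar; [apply Rmult_lt_0_compat|]; lra).
  destruct (bounded_below_eventually W K Ms M (Cmod lam) ((/ a) ^ 2) ((/ a') ^ 2) HMs HM Hloc)
    as [m0 Hm0].
  - apply pow2_ge_0.
  - nra.
  - assert (Hiff : forall A x, band W K A -> 0 < x ->
      Rbar_le (resnorm (matop (subId A lam))) x <-> bounded_below (subId A lam) ((/ x) ^ 2)).
    { intros A x HA Hx. rewrite <- (Rinv_inv x) at 1.
      apply (resnorm_le_iff W (K + Cmod lam)); [now apply band_subId|now apply Rinv_0_lt_compat]. }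
    exists m0; intros m Hm. destruct (Hm0 m lam Hm (Rle_refl _)) as [H3 H4].
    rewrite !Hiff by (auto; lra). split; auto.
Qed.

Lemma resnorm_convergent W K Ms M lam :
  (forall m, band W K (Ms m)) -> band W K M -> locally_convergent Ms M ->
  Rbar_cvg (fun m => resnorm (matop (subId (Ms m) lam))) (resnorm (matop (subId M lam))).
Proof.
  intros HMs HM Hloc.
  assert (Hpos := resnorm_pos _ _ _ (band_subId W K M lam HM)).
  assert (HT := fun a a' => resnorm_le_eventually W K Ms M lam a a' HMs HM Hloc).
  destruct (resnorm (matop (subId M lam))) as [r| |]; simpl in Hpos |- *; [| |tauto].
  - intros [eps Heps]. cbn [pos].
    (* Keeps [r - e] positive, so that it is an admissible level. If the norm at [m] were at most
       [r - e], transferring back would give [r <= r - e / 2]. *)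
    set (e := Rmin eps r / 2).
    assert (Hmin : 0 < Rmin eps r) by now apply Rmin_glb_lt.
    assert (He : 0 < e) by (unfold e; lra).
    assert (He1 : e < eps) by (generalize (Rmin_l eps r); unfold e in *; lra).
    assert (He2 : e < r) by (generalize (Rmin_r eps r); unfold e in *; lra).
    destruct (HT r (r + e)) as [m1 H1]; [lra|].
    destruct (HT (r - e) (r - e / 2)) as [m2 H2]; [lra|].
    exists (m1 + m2)%nat; intros m Hm.
    destruct (H1 m ltac:(lia)) as [H3 _]. destruct (H2 m ltac:(lia)) as [_ H4].
    specialize (H3 (Rle_refl r)).
    destruct (resnorm (matop (subId (Ms m) lam))) as [x| |]; simpl in H3, H4.
    + exists x; split; auto. apply Rabs_def1; [lra|].
      apply Rnot_le_lt; intros Hx. assert (r <= r - e / 2) by (apply H4; lra). lra.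
    + tauto.
    + exfalso. specialize (H4 I). lra.
  - intros k. set (a := Rmax k 1).
    assert (Ha : 1 <= a) by apply Rmax_r. assert (Hka : k <= a) by apply Rmax_l.
    destruct (HT a (a + 1)) as [m0 H]; [lra|].
    exists m0; intros m Hm. destruct (H m Hm) as [_ H2].
    destruct (resnorm (matop (subId (Ms m) lam))) as [x| |]; simpl in H2 |- *; auto.
    apply Rnot_le_lt; intros Hx. apply H2; lra.
Qed.

(** * Hausdorff distance and convergence of (pseudo)spectra *)

Lemma dist_set_le (B : C -> Prop) a b eta : B b -> Cmod (Cminus a b) <= eta ->
  exists r, dist_set a B = Finite r /\ 0 <= r <= eta.
Proof.
  intros Hb Hab. unfold dist_set. set (E := fun r => exists b, _).
  destruct (Glb_Rbar_correct E) as [Hlb Hglb].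
  assert (H1 : Rbar_le (Glb_Rbar E) (Cmod (Cminus a b))) by (apply Hlb; exists b; auto).
  assert (H2 : Rbar_le 0 (Glb_Rbar E)).
  { apply Hglb. intros r (c & _ & ->). apply Cmod_ge_0. }
  destruct (Glb_Rbar E) as [r| |]; simpl in H1, H2; [|tauto..].
  exists r; split; auto; lra.
Qed.

(** A point of [A] is needed because the supremum of the empty set is [m_infty]; nearby points of
    [B] make all the distances finite. *)
Lemma excess_le (A B : C -> Prop) eta : (exists a, A a) ->
  (forall a, A a -> exists b, B b /\ Cmod (Cminus a b) <= eta) ->
  exists r, excess A B = Finite r /\ 0 <= r <= eta.
Proof.
  intros [a Ha] H. unfold excess. set (E := fun r => exists a, _).
  destruct (Lub_Rbar_correct E) as [Hub Hlub].
  assert (Hr : forall r, E r -> 0 <= r <= eta).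
  { intros r (c & Hc & Er). destruct (H c Hc) as (b & Hb & Hcb).
    destruct (dist_set_le B c b eta Hb Hcb) as (r' & E' & Hr'). rewrite Er in E'.
    injection E' as ->. auto. }
  destruct (H a Ha) as (b & Hb & Hab).
  destruct (dist_set_le B a b eta Hb Hab) as (r & Er & Hr0).
  assert (H1 : Rbar_le r (Lub_Rbar E)) by (apply Hub; exists a; auto).
  assert (H2 : Rbar_le (Lub_Rbar E) eta) by (apply Hlub; intros x Hx; now apply Hr).
  destruct (Lub_Rbar E) as [l| |]; simpl in H1, H2; [|tauto..].
  exists l; split; auto; lra.
Qed.

Lemma hausdorff_convergent (As : nat -> C -> Prop) (A : C -> Prop) :
  (forall m, exists a, As m a) -> (exists a, A a) ->
  (forall eta, 0 < eta -> eventually (fun m =>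
     (forall a, As m a -> exists b, A b /\ Cmod (Cminus a b) <= eta)
     /\ (forall a, A a -> exists b, As m b /\ Cmod (Cminus a b) <= eta))) ->
  Rbar_cvg (fun m => hausdorff (As m) A) (Finite 0).
Proof.
  intros HAs HA H [eps Heps]. assert (He : 0 < eps / 2) by lra.
  destruct (H _ He) as [m0 Hm0]. exists m0; intros m Hm. cbn [pos].
  destruct (Hm0 m Hm) as [H1 H2].
  destruct (excess_le _ _ _ (HAs m) H1) as (r1 & E1 & Hr1).
  destruct (excess_le _ _ _ HA H2) as (r2 & E2 & Hr2).
  unfold hausdorff.
  destruct (excluded_middle_informative (exists a, As m a)) as [_|n]; [|destruct (n (HAs m))].
  destruct (excluded_middle_informative (exists a, A a)) as [_|n]; [|destruct (n HA)].
  rewrite E1, E2. unfold Rbar_max2.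
  destruct (excluded_middle_informative _); [exists r2|exists r1]; split; auto;
    rewrite Rminus_0_r, Rabs_pos_eq; lra.
Qed.

Lemma pseudospec_iff W K M lam e : band W K M -> 0 < e ->
  pseudospec e M lam <-> ~ bounded_below (subId M lam) (e ^ 2).
Proof.
  intros HM He. rewrite <- (resnorm_le_iff W (K + Cmod lam)) by (auto using band_subId).
  unfold pseudospec. split; [apply Rbar_lt_not_le|apply Rbar_not_le_lt].
Qed.

Lemma pseudospec_convergent W K Ms M e :
  (forall m, band W K (Ms m)) -> band W K M -> locally_convergent Ms M -> 0 < e ->
  Rbar_cvg (fun m => hausdorff (pseudospec e (Ms m)) (pseudospec e M)) (Finite 0).
Proof.
  intros HMs HM Hloc He.
  assert (Hne : forall A, band W K A -> exists a, pseudospec e A a).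
  { intros A HA. destruct (not_bounded_below_exists W K A e HA He) as [a Ha].
    exists a. now apply (pseudospec_iff W K). }
  apply hausdorff_convergent; auto.
  intros eta Heta. set (R0 := opbound W K + e).
  assert (HR0 : 0 <= R0) by (generalize (opbound_nonneg W K M HM); unfold R0; lra).
  destruct (not_bounded_below_step W K R0 e eta (proj1 HM) HR0 He Heta) as (delta & Hdelta & Hstep).
  destruct (bounded_below_eventually W K Ms M R0 ((e + delta) ^ 2) (e ^ 2) HMs HM Hloc) as [m0 Hm0];
    [apply pow2_ge_0|nra|].
  (* Symmetric in the two matrices: failure of the level [e] at a point transfers to failure of
     [e + delta] for the other matrix, and moving the point by at most [eta] restores failure of
     [e]. *)
  assert (Hcmp : forall A A', band W K A -> band W K A' ->
    (forall lam, Cmod lam <= R0 ->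
       bounded_below (subId A' lam) ((e + delta) ^ 2) -> bounded_below (subId A lam) (e ^ 2)) ->
    forall a, pseudospec e A a -> exists b, pseudospec e A' b /\ Cmod (Cminus a b) <= eta).
  { intros A A' HA HA' HAA a Ha. rewrite (pseudospec_iff W K) in Ha by auto.
    assert (Ha0 : Cmod a <= R0).
    { apply Rnot_lt_le; intros Hlt. apply Ha, (bounded_below_far W K); auto; unfold R0 in Hlt; lra. }
    destruct (Hstep A' a HA' Ha0) as (b & Hb & Hbb); [now intros H; apply Ha, HAA|].
    exists b; split; [now apply (pseudospec_iff W K)|].
    replace (Cminus a b) with (Copp (Cminus b a)) by ring. now rewrite Cmod_opp. }
  exists m0; intros m Hm; split; apply Hcmp; auto; intros lam Hlam.
  - exact (proj1 (Hm0 m lam Hm Hlam)).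
  - exact (proj2 (Hm0 m lam Hm Hlam)).
Qed.

Lemma spectrum_convergent W K Ms M :
  (forall m, band W K (Ms m)) -> band W K M -> locally_convergent Ms M ->
  (forall m, normalM (Ms m)) -> normalM M ->
  Rbar_cvg (fun m => hausdorff (spectrum (Ms m)) (spectrum M)) (Finite 0).
Proof.
  intros HMs HM Hloc HNs HN.
  assert (Hne : forall A, band W K A -> normalM A -> exists a, spectrum A a).
  { intros A HA HNA. destruct (not_bounded_below_exists W K A 1 HA Rlt_0_1) as [a Ha].
    destruct (normal_spectrum_near W K A a 1 HA HNA Rlt_0_1 Ha) as (b & _ & Hb). eauto. }
  apply hausdorff_convergent; auto.
  (* A spectral point fails every level, in particular [s / 2]; hence the other matrix fails [s]
     there and has spectrum within [50 * s = eta]. *)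
  intros eta Heta. set (R0 := opbound W K + 1). set (s := eta / 50).
  assert (Hs : 0 < s) by (unfold s; lra).
  destruct (bounded_below_eventually W K Ms M R0 (s ^ 2) ((s / 2) ^ 2) HMs HM Hloc) as [m0 Hm0];
    [apply pow2_ge_0|nra|].
  assert (Hcmp : forall A A', band W K A -> band W K A' -> normalM A' ->
    (forall lam, Cmod lam <= R0 ->
       bounded_below (subId A' lam) (s ^ 2) -> bounded_below (subId A lam) ((s / 2) ^ 2)) ->
    forall a, spectrum A a -> exists b, spectrum A' b /\ Cmod (Cminus a b) <= eta).
  { intros A A' HA HA' HNA' HAA a Ha. rewrite (spectrum_iff W K) in Ha by auto.
    assert (Ha0 : Cmod a <= R0).
    { apply Rnot_lt_le; intros Hlt. apply (Ha 1 Rlt_0_1), (bounded_below_far W K); auto; unfold R0 in Hlt; lra. }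
    destruct (normal_spectrum_near W K A' a s HA' HNA' Hs) as (b & Hb & Hbb).
    { intros H. apply (Ha (s / 2)); [lra|auto]. }
    exists b; split; auto.
    replace (Cminus a b) with (Copp (Cminus b a)) by ring. rewrite Cmod_opp. unfold s in Hb; lra. }
  exists m0; intros m Hm; split; apply Hcmp; auto; intros lam Hlam.
  - exact (proj1 (Hm0 m lam Hm Hlam)).
  - exact (proj2 (Hm0 m lam Hm Hlam)).
Qed.

(** * Half-axis Schroedinger operators *)

Lemma list_Cmod_bounded (l : list C) : exists B, 0 <= B /\ forall c, In c l -> Cmod c <= B.
Proof.
  induction l as [|a l (B & HB & H)].
  - exists 0; split; [lra|intros c []].
  - exists (Rmax (Cmod a) B). split; [apply Rle_trans with (2 := Rmax_r _ _); auto|].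
    intros c [<-|Hc]; [apply Rmax_l|]. apply Rle_trans with (2 := Rmax_r _ _); auto.
Qed.

Lemma Hplus_band (Lm : Z -> Z -> C) gamma w KL B :
  (forall i j : Z, (Z.of_nat w < Z.abs (i - j))%Z -> Lm i j = RtoC 0) ->
  (forall i j : Z, Cmod (Lm i j) <= KL) -> 0 <= B ->
  forall u, (forall n, Cmod (u n) <= B) ->
  band (Nat.max w (Z.abs_nat gamma)) (KL + B) (Hplus Lm gamma u).
Proof.
  intros HL HK HB u Hu. split.
  - generalize (HK 0%Z 0%Z) (Cmod_ge_0 (Lm 0%Z 0%Z)); lra.
  - intros i j. unfold Hplus.
    destruct (indic_cases (i - Nat.max w (Z.abs_nat gamma)) (i + Nat.max w (Z.abs_nat gamma) + 1) j)
      as [[Hj ->]|[Hj ->]].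
    + eapply Rle_trans; [apply Cmod_triangle|]. rewrite Rmult_1_r. apply Rplus_le_compat; auto.
      destruct (Z.eqb _ _); auto. now rewrite Cmod_0.
    + rewrite HL by lia. destruct (Z.eqb_spec (Z.of_nat j) (Z.of_nat i - gamma)); [lia|].
      rewrite Cplus_0_l, Cmod_0; lra.
Qed.

(** Commuting with the shift makes [Lm] constant along diagonals, so a diagonal block depends on its
    position only through the potential values at its columns. *)
Lemma Hplus_matching (Lm : Z -> Z -> C) gamma u u' L :
  (forall i j : Z, Lm i (j + 1)%Z = Lm (i - 1)%Z j) ->
  (forall s, exists s', (s = O -> s' = O) /\ forall j, (j < L)%nat -> u (s + j)%nat = u' (s' + j)%nat) ->
  matching (Hplus Lm gamma u) (Hplus Lm gamma u') L.
Proof.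
  intros HLS Hu s. destruct (Hu s) as (s' & H0 & Heq). exists s'; split; auto.
  assert (HT : forall (k : nat) i j, Lm (i + Z.of_nat k)%Z (j + Z.of_nat k)%Z = Lm i j).
  { induction k as [|k IH]; intros i j; [now rewrite !Z.add_0_r|].
    replace (j + Z.of_nat (S k))%Z with (j + Z.of_nat k + 1)%Z by lia.
    rewrite HLS. replace (i + Z.of_nat (S k) - 1)%Z with (i + Z.of_nat k)%Z by lia. apply IH. }
  intros i j Hi Hj. unfold Hplus. f_equal.
  - rewrite <- (HT s' (Z.of_nat (s + i) + 1)%Z), <- (HT s (Z.of_nat (s' + i) + 1)%Z).
    f_equal; lia.
  - rewrite Heq by auto.
    destruct (Z.eqb_spec (Z.of_nat (s + j)) (Z.of_nat (s + i) - gamma)),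
      (Z.eqb_spec (Z.of_nat (s' + j)) (Z.of_nat (s' + i) - gamma)); auto; lia.
Qed.

(** A finite alphabet is discrete, so pointwise convergence means that each letter is eventually
    constant. *)
Lemma finite_eventually_eq (l : list C) (u : nat -> C) c :
  (forall m, In (u m) l) -> filterlim u eventually (locally c) -> eventually (fun m => u m = c).
Proof.
  intros Hl Hu.
  assert (Hsep : exists rho : posreal, forall z, In z l -> ball c rho z -> z = c).
  { clear Hl. induction l as [|a l [rho IH]].
    - exists (mkposreal 1 Rlt_0_1). intros z [].
    - destruct (classic (a = c)) as [->|Hac].
      + exists rho. intros z [<-|Hz] Hb; auto.
      + assert (Hm : 0 < Rabs (fst a - fst c) + Rabs (snd a - snd c)).
        { apply Rnot_le_lt; intros H. apply Hac.
          generalize (Rabs_pos (fst a - fst c)) (Rabs_pos (snd a - snd c)); intros H1 H2.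
          apply injective_projections; apply Rminus_diag_uniq, Rabs_eq_0; lra. }
        set (m := _ + _) in Hm.
        (* Balls in [C] are products of intervals, while [m] adds up both coordinate distances; half
           of [m] therefore excludes [a]. *)
        assert (Hr : 0 < Rmin rho (m / 2)) by (apply Rmin_glb_lt; [apply cond_pos|lra]).
        exists (mkposreal _ Hr). intros z [<-|Hz] [Hb1 Hb2]; cbn [pos] in *.
        * exfalso. unfold ball in Hb1, Hb2; simpl in Hb1, Hb2.
          unfold AbsRing_ball, abs, minus, plus, opp in Hb1, Hb2; simpl in Hb1, Hb2.
          generalize (Rmin_r rho (m / 2)). unfold m, Rminus in *. lra.
        * apply IH; auto. split; apply ball_le with (Rmin rho (m / 2)); auto; apply Rmin_l. }
  destruct Hsep as [rho Hrho].
  assert (Hev : eventually (fun m => ball c rho (u m))) by (apply Hu; now exists rho).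
  destruct Hev as [m0 Hm0]. exists m0; intros m Hm. apply Hrho; auto.
Qed.

Lemma eventually_forall_lt (P : nat -> nat -> Prop) L :
  (forall j, eventually (P j)) -> eventually (fun m => forall j, (j < L)%nat -> P j m).
Proof.
  intros H. induction L as [|L [m0 IH]]; [exists O; intros; lia|].
  destruct (H L) as [m1 H1]. exists (m0 + m1)%nat. intros m Hm j Hj.
  destruct (Nat.eq_dec j L) as [->|Hn]; [apply H1; lia|apply IH; lia].
Qed.

Lemma words_window N u v k : (forall w, words N u w -> words N v w) ->
  exists k', forall j, (j < N)%nat -> u (k + j)%nat = v (k' + j)%nat.
Proof.
  intros H. destruct (H (map (fun i => u (k + i)%nat) (seq 0 N))) as [k' E]; [now exists k|].
  exists k'. intros j Hj.
  (* The default is the mapped function at 0, the form required by [map_nth]. *)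
  apply (f_equal (fun l => nth j l (u (k + 0)%nat))) in E.
  rewrite (map_nth (fun i => u (k + i)%nat)) in E.
  rewrite (nth_indep _ _ (v (k' + 0)%nat)) in E by (rewrite length_map, length_seq; auto).
  rewrite (map_nth (fun i => v (k' + i)%nat)) in E.
  now rewrite seq_nth in E.
Qed.

Lemma Hplus_locally_convergent (Sigma : list C) (Lm : Z -> Z -> C) gamma b bs :
  (forall i j : Z, Lm i (j + 1)%Z = Lm (i - 1)%Z j) ->
  (forall m n, In (bs m n) Sigma) ->
  (forall N : nat, (1 <= N)%nat -> exists m0 : nat, forall m : nat,
      (m0 <= m)%nat -> forall w, words N (bs m) w <-> words N b w) ->
  (forall n : nat, filterlim (fun m => bs m n) eventually (locally (b n))) ->
  locally_convergent (fun m => Hplus Lm gamma (bs m)) (Hplus Lm gamma b).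
Proof.
  intros HLS Hbs Hwords Hpt L.
  (* Length [S L] rather than [L], because the hypothesis on words requires a positive length. *)
  destruct (Hwords (S L)) as [m1 H1]; [lia|].
  destruct (eventually_forall_lt (fun j m => bs m j = b j) L) as [m2 H2].
  { intros j. now apply (finite_eventually_eq Sigma). }
  exists (m1 + m2)%nat. intros m Hm.
  specialize (H1 m ltac:(lia)). specialize (H2 m ltac:(lia)).
  (* The corner block is matched with the corner block by the pointwise convergence of prefixes; all
     other blocks are matched by equality of the word sets, at an uncontrolled position. *)
  split; apply Hplus_matching; auto; intros [|s].
  - exists O; split; auto.
  - destruct (words_window (S L) (bs m) b (S s)) as [s' Hs']; [intros; now apply H1|].
    exists s'; split; [discriminate|auto].
  - exists O; split; auto. intros; symmetry; auto.
  - destruct (words_window (S L) b (bs m) (S s)) as [s' Hs']; [intros; now apply H1|].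
    exists s'; split; [discriminate|auto].
Qed.

Theorem theorem4p12
  (Sigma : list C) (HSigma : Sigma <> nil)
  (Lm : Z -> Z -> C)
  (HLband : exists w : nat, forall i j : Z,
      (Z.of_nat w < Z.abs (i - j))%Z -> Lm i j = RtoC 0)
  (HLbdd : exists K : R, forall i j : Z, Cmod (Lm i j) <= K)
  (HLS : forall i j : Z, Lm i (j + 1)%Z = Lm (i - 1)%Z j)
  (gamma : Z)
  (b : nat -> C) (bs : nat -> nat -> C)
  (Hb : forall n, In (b n) Sigma)
  (Hbs : forall m n, In (bs m n) Sigma)
  (Hwords : forall N : nat, (1 <= N)%nat -> exists m0 : nat, forall m : nat,
      (m0 <= m)%nat -> forall w, words N (bs m) w <-> words N b w)
  (Hpt : forall n : nat, filterlim (fun m => bs m n) eventually (locally (b n))) :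
  (forall (lam : C) (eps : R), 0 < eps ->
     Rbar_cvg (fun m => resnorm (matop (subId (Hplus Lm gamma (bs m)) lam)))
              (resnorm (matop (subId (Hplus Lm gamma b) lam)))
     /\ Rbar_cvg (fun m => hausdorff (pseudospec eps (Hplus Lm gamma (bs m)))
                                     (pseudospec eps (Hplus Lm gamma b)))
                 (Finite 0))
  /\
  ((forall m, normalM (Hplus Lm gamma (bs m))) -> normalM (Hplus Lm gamma b) ->
     Rbar_cvg (fun m => hausdorff (spectrum (Hplus Lm gamma (bs m)))
                                  (spectrum (Hplus Lm gamma b)))
              (Finite 0)).
Proof.
  destruct HLband as [w Hw], HLbdd as [KL HKL].
  destruct (list_Cmod_bounded Sigma) as (B & HB & HBs).
  assert (Hband := Hplus_band Lm gamma w KL B Hw HKL HB).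
  assert (HM := Hband b (fun n => HBs _ (Hb n))).
  assert (HMs := fun m => Hband (bs m) (fun n => HBs _ (Hbs m n))).
  assert (Hloc := Hplus_locally_convergent Sigma Lm gamma b bs HLS Hbs Hwords Hpt).
  split.
  - intros lam eps Heps; split.
    + exact (resnorm_convergent _ _ _ _ lam HMs HM Hloc).
    + exact (pseudospec_convergent _ _ _ _ eps HMs HM Hloc Heps).
  - exact (spectrum_convergent _ _ _ _ HMs HM Hloc).
Qed.
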